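(* Let $(\mathcal{A},\rho,\Sigma)$ be a $C^*$-symbolic dynamical system satisfying condition (I), with associated subshift $\Lambda$. If $(\mathcal{A},\rho,\Sigma)$ is irreducible, then the $C^*$-algebra $\mathcal{A}\rtimes_\rho\Lambda$ is simple.
   Context: Conventions: homomorphisms and endomorphisms of $C^*$-algebras are $*$-preserving; endomorphisms need not be unital; ideals are closed and two-sided. A $C^*$-symbolic dynamical system $(\mathcal{A},\rho,\Sigma)$ consists of a unital $C^*$-algebra $\mathcal{A}$, a finite set $\Sigma$ and endomorphisms $\rho_\alpha$ of $\mathcal{A}$ ($\alpha\in\Sigma$) that are essential ($\rho_\alpha(1)\neq 0$ for all $\alpha$, and the closed ideal generated by $\{\rho_\alpha(1)\}_{\alpha\in\Sigma}$ is $\mathcal{A}$) and faithful (for every nonzero $x\in\mathcal{A}$ there is $\alpha\in\Sigma$ with $\rho_\alpha(x)\neq0$). For a word $\mu=(\mu_1,\dots,\mu_k)$ put $\rho_\mu=\rho_{\mu_k}\circ\cdots\circ\rho_{\mu_1}$. The associated subshift $\Lambda$ over $\Sigma$ is the one whose admissible words are exactly the words $\mu$ with $\rho_\mu(1)\neq0$; $\Lambda^k$ is the set of admissible words of length $k$ ($\Lambda^0$ consists of the empty word) and $\Lambda^*=\bigcup_{k\ge0}\Lambda^k$. The $C^*$-symbolic crossed product $\mathcal{A}\rtimes_\rho\Lambda$ is the universal unital $C^*$-algebra generated by $\mathcal{A}$ and partial isometries $S_\alpha$, $\alpha\in\Sigma$, subject to $\sum_{\beta\in\Sigma}S_\beta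 S_\beta^*=1$, $S_\alpha^*xS_\alpha=\rho_\alpha(x)$, $xS_\alpha S_\alpha^*=S_\alpha S_\alpha^*x$ for $x\in\mathcal{A}$, $\alpha\in\Sigma$ ($\mathcal{A}$ is known to embed). Put $S_\mu=S_{\mu_1}\cdots S_{\mu_k}$ and let $\mathcal{D}_\rho$ be the $C^*$-subalgebra generated by all $S_\mu xS_\mu^*$, $\mu\in\Lambda^*$, $x\in\mathcal{A}$. Condition (I): there is an increasing sequence $\mathcal{A}_0\subset\mathcal{A}_1\subset\cdots$ of unital $C^*$-subalgebras of $\mathcal{A}$ with $\rho_\alpha(\mathcal{A}_l)\subset\mathcal{A}_{l+1}$ for all $l\ge0$, $\alpha\in\Sigma$, with $\bigcup_l\mathcal{A}_l$ dense in $\mathcal{A}$, and for all positive integers $k\le l$ there is a projection $q_k^l\in\mathcal{D}_\rho$ commuting with every element of $\mathcal{A}_l$ such that (i) $q_k^la\neq0$ for all nonzero $a\in\mathcal{A}_l$; (ii) $q_k^l\phi_\rho^m(q_k^l)=0$ for $m=1,\dots,k$, where $\phi_\rho^m(X)=\sum_{\mu\in\Lambda^m}S_\mu XS_\mu^*$. Let $\lambda_\rho(x)=\sum_{\alpha\in\Sigma}\rho_\alpha(x)$ for $x\in\mathcal{A}$. $(\mathcal{A},\rho,\Sigma)$ is irreducible if there is no nontrivial ideal $J$ of $\mathcal{A}$ (i.e. $\{0\}\ne J\ne\mathcal{A}$) with $\lambda_\rho(J)\subset J$. *)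

(* Defs.v *)
From HB Require Import structures.
From mathcomp Require Import all_boot all_order all_algebra.
From mathcomp Require Import all_classical all_reals all_analysis.
From mathcomp Require Import complex.

Set Implicit Arguments.
Unset Strict Implicit.
Unset Printing Implicit Defensive.

Import Order.TTheory GRing.Theory Num.Theory.
Import numFieldNormedType.Exports.

Local Open Scope classical_set_scope.
Local Open Scope ring_scope.
Local Open Scope complex_scope.

(* Normed modules and complete spaces cannot be joined with rings in the
   hierarchy, so norm and completeness are part of the mixin; [cnorm_entourage]
   makes the uniformity, hence the topology, that of the norm. Since the
   algebra structure is a nonzero ring, [1 != 0] is built in. *)
HB.mixin Record isCStarAlgebra (R : realType) A
    of GRing.Algebra R[i] A & Uniform A := {
  cnorm : A -> R;
  cnorm0_eq0 : forall x : A, cnorm x = 0 -> x = 0;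
  cnormD : forall x y : A, cnorm (x + y) <= cnorm x + cnorm y;
  cnormZ : forall (c : R[i]) (x : A),
    (cnorm (c *: x))%:C = `|c| * (cnorm x)%:C;
  cnormM : forall x y : A, cnorm (x * y) <= cnorm x * cnorm y;
  cnorm_entourage : @entourage A = entourage_ (ball_ cnorm);
  cstar_complete : forall F : set_system A,
    ProperFilter F -> cauchy F -> exists x : A, F --> x;
  star : A -> A;
  starD : forall x y : A, star (x + y) = star x + star y;
  starZ : forall (c : R[i]) (x : A), star (c *: x) = c^* *: star x;
  starM : forall x y : A, star (x * y) = star y * star x;
  starK : forall x : A, star (star x) = x;
  cnorm_star : forall x : A, cnorm (star x * x) = cnorm x ^+ 2
}.

#[short(type="cstarType")]
HB.structure Definition CStarAlgebra (R : realType) :=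
  { A of GRing.Algebra R[i] A & Uniform A
       & isCStarAlgebra R A }.

Section CStarNotions.
Context {R : realType}.

(* Not required to be unital. *)
Record star_hom (A B : cstarType R) (f : A -> B) : Prop := StarHom {
  star_hom_linear : linear f;
  star_homM : {morph f : x y / x * y};
  star_hom_star : {morph f : x / star x}
}.

(* Not required to contain the unit. *)
Record cstar_subalgebra (A : cstarType R) (X : set A) : Prop := CStarSubalgebra {
  cstar_subalgebra0 : X 0;
  cstar_subalgebraD : forall x y, X x -> X y -> X (x + y);
  cstar_subalgebraZ : forall (c : R[i]) x, X x -> X (c *: x);
  cstar_subalgebraM : forall x y, X x -> X y -> X (x * y);
  cstar_subalgebra_star : forall x, X x -> X (star x);
  cstar_subalgebra_closed : closed X
}.

Definition cstar_generated (A : cstarType R) (X : set A) : set A :=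
  smallest (@cstar_subalgebra A) X.

Record closed_ideal (A : cstarType R) (J : set A) : Prop := ClosedIdeal {
  closed_ideal0 : J 0;
  closed_idealD : forall x y, J x -> J y -> J (x + y);
  closed_idealZ : forall (c : R[i]) x, J x -> J (c *: x);
  closed_idealMl : forall a x, J x -> J (a * x);
  closed_idealMr : forall a x, J x -> J (x * a);
  closed_ideal_closed : closed J
}.

Definition nontrivial_ideal (A : cstarType R) (J : set A) : Prop :=
  [/\ closed_ideal J, J <> [set 0] & J <> setT].

Definition simple_cstar (A : cstarType R) : Prop :=
  ~ exists J : set A, nontrivial_ideal J.

Definition projection (A : cstarType R) (q : A) : Prop :=
  q * q = q /\ star q = q.

Definition partial_isometry (A : cstarType R) (s : A) : Prop :=
  s * star s * s = s.

End CStarNotions.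

Section SymbolicDynamics.
Context {R : realType} {A : cstarType R} {Sigma : finType}.
Variable rho : Sigma -> A -> A.

Record cstar_symbolic_dynamical_system : Prop := CStarSymbolicDynamicalSystem {
  csds_hom : forall a, star_hom (rho a);
  csds_neq0 : forall a, rho a 1 <> 0;
  csds_full : smallest (@closed_ideal R A) [set rho a 1 | a in setT] = setT;
  csds_faithful : forall x, x <> 0 -> exists a, rho a x <> 0
}.

(* rho_(mu_1 ... mu_k) = rho_(mu_k) \o ... \o rho_(mu_1) *)
Definition rho_word (mu : seq Sigma) (x : A) : A :=
  foldl (fun y a => rho a y) x mu.

(* Membership in the language of the subshift Lambda. *)
Definition admissible (mu : seq Sigma) : bool := rho_word mu 1 != 0.

Definition lambda_rho (x : A) : A := \sum_(a : Sigma) rho a x.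

Definition irreducible_system : Prop :=
  ~ exists J : set A, nontrivial_ideal J /\ lambda_rho @` J `<=` J.

End SymbolicDynamics.

Section CrossedProduct.
Context {R : realType} {A : cstarType R} {Sigma : finType}.
Variable rho : Sigma -> A -> A.

Record covariant_family (B : cstarType R) (iota : A -> B) (S : Sigma -> B)
    : Prop := CovariantFamily {
  covariant_hom : star_hom iota;
  covariant_unital : iota 1 = 1;
  covariant_isometry : forall a, partial_isometry (S a);
  covariant_sum : \sum_(b : Sigma) S b * star (S b) = 1;
  covariant_rho : forall a x, star (S a) * iota x * S a = iota (rho a x);
  covariant_comm :
    forall a x, iota x * (S a * star (S a)) = (S a * star (S a)) * iota x
}.

(* The crossed product is given by its universal property: [B], together with
   the images [iota] of A and [S] of the generators, is a model of it. The map
   [f] is unique because [B] is generated by [iota] and [S]. *)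
Record is_crossed_product (B : cstarType R) (iota : A -> B) (S : Sigma -> B)
    : Prop := IsCrossedProduct {
  crossed_product_covariant : covariant_family iota S;
  crossed_product_generated :
    cstar_generated (range iota `|` range S) = setT;
  crossed_product_universal :
    forall (D : cstarType R) (pi : A -> D) (T : Sigma -> D),
      covariant_family pi T ->
      exists f : B -> D,
        [/\ star_hom f, f 1 = 1, (forall x, f (iota x) = pi x)
          & (forall a, f (S a) = T a)]
}.

Variables (B : cstarType R) (iota : A -> B) (S : Sigma -> B).

Definition S_word (mu : seq Sigma) : B := \prod_(a <- mu) S a.

Definition D_rho : set B :=
  cstar_generated [set y | exists mu : seq Sigma, exists x : A,
    admissible rho mu /\ y = S_word mu * iota x * star (S_word mu)].

Definition phi_rho (m : nat) (X : B) : B :=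
  \sum_(mu : m.-tuple Sigma | admissible rho mu)
    S_word mu * X * star (S_word mu).

(* A is identified with its image under [iota] inside the crossed product. *)
Definition condition_I : Prop :=
  exists Al : nat -> set A,
    [/\ (forall l, cstar_subalgebra (Al l) /\ Al l 1),
        (forall l, Al l `<=` Al l.+1),
        (forall l a, rho a @` Al l `<=` Al l.+1),
        dense (\bigcup_l Al l)
      & forall k l : nat, (0 < k)%N -> (k <= l)%N ->
          exists q : B,
            [/\ D_rho q, projection q,
                (forall a, Al l a -> q * iota a = iota a * q),
                (forall a, Al l a -> a <> 0 -> q * iota a <> 0)
              & (forall m, (1 <= m <= k)%N -> q * phi_rho m q = 0)]].

End CrossedProduct.

(* Main.v *)
Require Import Defs.
From mathcomp Require Import all_boot all_order all_algebra.
From mathcomp Require Import all_classical all_reals all_analysis.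
From mathcomp Require Import complex ring lra zify cyclic separable cyclotomic.

Set Implicit Arguments.
Unset Strict Implicit.
Unset Printing Implicit Defensive.

Import Order.TTheory GRing.Theory Num.Theory.
Import numFieldNormedType.Exports.

Local Open Scope classical_set_scope.
Local Open Scope ring_scope.
Local Open Scope complex_scope.

(** Let J be a nonzero closed ideal of the crossed product B; we may assume J
    selfadjoint. The elements of A lying in J form a closed ideal invariant under
    lambda_rho, so by irreducibility it is 0 unless 1 is in J. Assume it is 0.

    For words of length k the decomposition 1 = sum S_mu S_mu^* identifies
    F_k = span S_mu A S_nu^* with matrices over A, so J meets F_k, and then the
    closure F of the union of the F_k, trivially, in the strong form
    |y| <= |y - j| for y in F and j in J. Let p = sum p_n be a finite sum of
    homogeneous elements for the gauge action, and x in J. Condition (I) provides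
    a projection Q in F which commutes with p_0, satisfies |Q p_0| = |p_0|, and
    kills the other terms: Q p Q = Q p_0. Hence
    |p_0| <= |Q p_0 - Q x Q| <= |p - x|, and multiplication by p_n^* extends the
    bound to |p_n| <= |p - x|. So all the Fourier coefficients of x vanish, and
    Fejer's kernel, discretized at roots of unity (the gauge automorphisms come
    from universality), gives x = 0.

    The C*-algebraic input needs no spectral theory: it rests on square roots
    of 1 - x for |x| <= 1 and on the bound |b|^2 <= |a^2 + b^2| for commuting
    selfadjoint a and b. *)

(** * Norm and closure in a C*-algebra *)

Section Norm.
Context {R : realType}.
Implicit Types (A : cstarType R) (t : R).

Lemma cnorm_scaleR A t (x : A) : cnorm (t%:C *: x) = `|t| * cnorm x.
Proof.
apply: complexI; rewrite cnormZ rmorphM /=; congr (_ * _).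
by rewrite normc_def /= expr0n addr0 sqrtr_sqr.
Qed.

Lemma cnorm_scale1 A (c : R[i]) (x : A) : `|c| = 1 -> cnorm (c *: x) = cnorm x.
Proof. by move=> c1; apply: complexI; rewrite cnormZ c1 mul1r. Qed.

Lemma cnorm0 A : cnorm (0 : A) = 0.
Proof. by have := cnorm_scaleR 0 (0 : A); rewrite scaler0 normr0 mul0r. Qed.

Lemma cnormN A (x : A) : cnorm (- x) = cnorm x.
Proof. by rewrite -scaleN1r cnorm_scale1 // normrN1. Qed.

Lemma cnormB A (x y : A) : cnorm (x - y) <= cnorm x + cnorm y.
Proof. by rewrite -(cnormN y) cnormD. Qed.

Lemma cdistC A (x y : A) : cnorm (x - y) = cnorm (y - x).
Proof. by rewrite -cnormN opprB. Qed.

Lemma cnorm_ge0 A (x : A) : 0 <= cnorm x.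
Proof. by have := cnormB x x; rewrite subrr cnorm0; lra. Qed.

Lemma cnorm_sum A (I : Type) (r : seq I) (P : pred I) (F : I -> A) :
  cnorm (\sum_(i <- r | P i) F i) <= \sum_(i <- r | P i) cnorm (F i).
Proof.
elim/big_ind2: _ => [||//]; first by rewrite cnorm0.
by move=> x s y t xs yt; apply: (le_trans (cnormD _ _)); apply: lerD.
Qed.

Lemma cnorm_gt0 A (x : A) : x <> 0 -> 0 < cnorm x.
Proof.
by move=> x0; rewrite lt0r cnorm_ge0 andbT; apply/eqP => /cnorm0_eq0.
Qed.

Lemma star0 A : star (0 : A) = 0.
Proof. by rewrite -[0 in LHS](scale0r (0 : A)) starZ conjC0 scale0r. Qed.

Lemma starN A (x : A) : star (- x) = - star x.
Proof. by apply/eqP; rewrite -addr_eq0 -starD addNr star0. Qed.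

Lemma starB A (x y : A) : star (x - y) = star x - star y.
Proof. by rewrite starD starN. Qed.

Lemma star_sum A (I : Type) (r : seq I) (P : pred I) (F : I -> A) :
  star (\sum_(i <- r | P i) F i) = \sum_(i <- r | P i) star (F i).
Proof. exact: (big_morph _ (@starD R A) (star0 A)). Qed.

Lemma star1 A : star (1 : A) = 1.
Proof. by rewrite -[LHS]mul1r -{1}[1]starK -starM mul1r starK. Qed.

Lemma conj_realC t : Num.conj (t%:C : R[i]) = t%:C.
Proof. by apply: conj_Creal; rewrite complex_real. Qed.

Lemma star_scaleR A t (x : A) : star (t%:C *: x) = t%:C *: star x.
Proof. by rewrite starZ conj_realC. Qed.

(** The C*-identity gives [cnorm y ^+ 2 <= cnorm (star y) * cnorm y]. Cancelling [cnorm y], then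
    exchanging [y] and [star y], gives both inequalities. *)
Lemma cnorm_starE A (x : A) : cnorm (star x) = cnorm x.
Proof.
have le (y : A) : cnorm y <= cnorm (star y).
  have := cnorm_ge0 y; rewrite le0r => /orP[/eqP->|y0]; first exact: cnorm_ge0.
  by rewrite -(ler_pM2r y0) -expr2 -cnorm_star cnormM.
by apply/eqP; rewrite eq_le le -{2}(starK x) le.
Qed.

Lemma cnorm_mulstar A (x : A) : cnorm (x * star x) = cnorm x ^+ 2.
Proof. by rewrite -{1}(starK x) cnorm_star cnorm_starE. Qed.

Lemma cnorm1 A : cnorm (1 : A) = 1.
Proof.
have n1 : cnorm (1 : A) != 0 by apply/eqP => /cnorm0_eq0/eqP; rewrite oner_eq0.
by have := cnorm_star (1 : A); rewrite star1 mulr1 expr2 -{1}[cnorm 1]mulr1 => /(mulfI n1).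
Qed.

Lemma cnorm_selfadj A (x : A) : star x = x -> cnorm (x * x) = cnorm x ^+ 2.
Proof. by move=> xx; rewrite -{1}xx cnorm_star. Qed.

Lemma nbhs_cnorm A (x : A) (U : set A) :
  nbhs x U <-> exists2 e, 0 < e & forall y, cnorm (x - y) < e -> U y.
Proof.
rewrite -nbhs_entourageE cnorm_entourage; split.
  case=> E [e /= e0 eE] EU; exists e => // y xy.
  by apply: EU; rewrite /xsection /= inE; apply: eE.
move=> [e /= e0 eU]; exists [set xy | cnorm (xy.1 - xy.2) < e].
  by exists e.
by move=> y; rewrite /xsection /= inE => /eU.
Qed.

(** Closure in terms of the norm; [closedP] ties it to the topology, so that approximation arguments
    need no filters. *)
Definition cl A (X : set A) : set A :=
  [set x | forall e, 0 < e -> exists2 y, X y & cnorm (x - y) < e].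

Lemma closedP A (X : set A) : closed X <-> cl X `<=` X.
Proof.
split=> [cX x clx|cX x clx].
  apply: cX => U /nbhs_cnorm[e e0 eU]; have [y Xy xy] := clx e e0.
  by exists y; split=> //; apply: eU.
apply: cX => e e0; have [|y [Xy xy]] := clx [set y | cnorm (x - y) < e].
  by apply/nbhs_cnorm; exists e.
by exists y.
Qed.

Lemma subset_cl A (X : set A) : X `<=` cl X.
Proof. by move=> x Xx e e0; exists x; rewrite // subrr cnorm0. Qed.

Lemma cl_subset A (X Y : set A) : X `<=` Y -> cl X `<=` cl Y.
Proof. by move=> XY x clx e /clx[y /XY]; exists y. Qed.

Lemma clK A (X : set A) : cl (cl X) `<=` cl X.
Proof.
move=> x clx e e0; have e2 : 0 < e / 2 by rewrite divr_gt0.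
have [y /(_ _ e2)[z Xz yz] xy] := clx _ e2.
exists z => //; rewrite -(subrKA y) (le_lt_trans (cnormD _ _)) //; lra.
Qed.

Lemma closed_cl A (X : set A) : closed (cl X).
Proof. by apply/closedP; exact: clK. Qed.

Lemma ccauchy_cvg A (s : nat -> A) :
  (forall e, 0 < e -> exists N, forall m n, (N <= m)%N -> (N <= n)%N ->
     cnorm (s m - s n) < e) ->
  exists l, forall e, 0 < e -> exists N, forall n, (N <= n)%N ->
     cnorm (l - s n) < e.
Proof.
move=> cs; have [] := @cstar_complete R A (s @ \oo).
  rewrite /cauchy cnorm_entourage => E [e /= e0 eE].
  have [N sN] := cs e e0.
  exists (s @` [set n | (N <= n)%N], s @` [set n | (N <= n)%N]) => /=.
    by split; exists N => // n Nn; exists n.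
  by move=> [_ _] /= [[m Nm <-] [n Nn <-]]; apply: eE; exact: sN.
move=> l sl; exists l => e e0.
have /sl[N _ NP] : nbhs l [set y | cnorm (l - y) < e].
  by apply/nbhs_cnorm; exists e.
by exists N => n /NP.
Qed.

Lemma closed_lim A (X : set A) (s : nat -> A) l : closed X -> (forall n, X (s n)) ->
  (forall e, 0 < e -> exists N, forall n, (N <= n)%N -> cnorm (l - s n) < e) ->
  X l.
Proof.
move=> /closedP cX Xs sl; apply: cX => e /sl[N NP].
by exists (s N) => //; apply: NP.
Qed.

End Norm.

(** * Square roots and inverses *)

Section Calculus.
Context {R : realType} {A : cstarType R}.
Implicit Types (x y z a b : A) (t : R).

Lemma closed_cball t : closed [set x : A | cnorm x <= t].
Proof.
apply/closedP => x clx /=; apply/ler_addgt0Pr => e e0.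
have [y /= yt xy] := clx e e0.
by have := cnormD (x - y) y; rewrite subrK; lra.
Qed.

Lemma eq0_small x : (forall e, 0 < e -> cnorm x <= e) -> x = 0.
Proof.
move=> xs; apply: cnorm0_eq0; apply/eqP; rewrite eq_le cnorm_ge0 andbT.
by apply/ler_addgt0Pr => e e0; rewrite add0r xs.
Qed.

(** Additivity and the bound make [g] Lipschitz. Dividing by [|K| + 1] in the proof avoids any
    condition on the sign of [K]. *)
Lemma closed_preimage (B : cstarType R) (g : A -> B) (K : R) (X : set B) :
  (forall x y, g (x - y) = g x - g y) ->
  (forall x, cnorm (g x) <= K * cnorm x) -> closed X ->
  closed [set x | X (g x)].
Proof.
move=> gB gK /closedP cX; apply/closedP => x clx /=; apply: cX => e e0.
have K0 : 0 < `|K| + 1 by rewrite ltr_wpDl.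
have [y /= Xy xy] := clx _ (divr_gt0 e0 K0).
exists (g y) => //; rewrite -gB (le_lt_trans (gK _)) //.
move: xy; rewrite ltr_pdivlMr // mulrC => /(le_lt_trans _); apply.
by rewrite ler_wpM2r ?cnorm_ge0 // (le_trans (ler_norm _)) // lerDl.
Qed.

Lemma closed_set0 : closed [set x : A | x = 0].
Proof.
suff -> : [set x : A | x = 0] = [set x | cnorm x <= 0] by exact: closed_cball.
apply/seteqP; split=> x /= => [->|x0]; first by rewrite cnorm0.
by apply: cnorm0_eq0; apply/eqP; rewrite eq_le x0 cnorm_ge0.
Qed.

Record closed_subalg (C : set A) : Prop := ClosedSubalg {
  closed_subalg1 : C 1;
  closed_subalgD : forall x y, C x -> C y -> C (x + y);
  closed_subalgZ : forall (c : R[i]) x, C x -> C (c *: x);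
  closed_subalgM : forall x y, C x -> C y -> C (x * y);
  closed_subalg_closed : closed C
}.

Lemma closed_subalgN C x : closed_subalg C -> C x -> C (- x).
Proof. by move=> sC Cx; rewrite -scaleN1r; exact: closed_subalgZ. Qed.

Lemma closed_subalgB C x y : closed_subalg C -> C x -> C y -> C (x - y).
Proof.
by move=> sC Cx Cy; apply: closed_subalgD => //; exact: closed_subalgN.
Qed.

Lemma closed_selfadj : closed [set x : A | star x = x].
Proof.
have -> : [set x : A | star x = x] = [set x | star x - x = 0].
  by apply/seteqP; split=> x /= => [->|/subr0_eq //]; rewrite subrr.
apply: (@closed_preimage _ (fun x => star x - x) 2 [set x | x = 0]).
- move=> x y; rewrite starB !opprB addrACA (addrC (- _)) addrACA.
  by congr (_ + _); rewrite addrC.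
- by move=> x; rewrite (le_trans (cnormB _ _)) // cnorm_starE; lra.
- exact: closed_set0.
Qed.

Lemma commutant_subalg z : closed_subalg [set x | x * z = z * x].
Proof.
split=> /=.
- by rewrite mul1r mulr1.
- by move=> x y xz yz; rewrite mulrDl mulrDr xz yz.
- by move=> c x xz; rewrite -scalerAl -scalerAr xz.
- by move=> x y xz yz; rewrite -mulrA yz !mulrA xz.
have -> : [set x | x * z = z * x] = [set x | x * z - z * x = 0].
  by apply/seteqP; split=> x /= => [->|/subr0_eq //]; rewrite subrr.
apply: (@closed_preimage _ (fun x => x * z - z * x) (2 * cnorm z) [set x | x = 0]).
- move=> x y; rewrite mulrBl mulrBr !opprB addrACA (addrC (- _)) addrACA.
  by congr (_ + _); rewrite addrC.
- move=> x; rewrite (le_trans (cnormB _ _)) //.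
  by have := cnormM x z; have := cnormM z x; lra.
- exact: closed_set0.
Qed.

(* The C*-identity for n = a + ib, whose imaginary part is b. *)
Lemma cnorm_sqr_le a b : star a = a -> star b = b -> a * b = b * a ->
  cnorm b ^+ 2 <= cnorm (a * a + b * b).
Proof.
move=> sa sb ab; pose n := a + 'i%R *: b.
have sn : star n = a - 'i%R *: b.
  by rewrite starD starZ sa sb conjCi scaleNr.
have nn : n * star n = a * a + b * b.
  rewrite sn mulrDl !mulrBr -!scalerAl -!scalerAr ab scalerA -(expr2 'i%R) sqrCi.
  by rewrite scaleN1r opprK -addrA addKr.
rewrite -nn cnorm_mulstar ler_sqr ?nnegrE ?cnorm_ge0 //.
(* [n - star n] is twice ['i *: b], which bounds [cnorm b] by [cnorm n]. *)
have : cnorm ('i%R *: b + 'i%R *: b) <= cnorm n + cnorm n.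
  rewrite -[X in _ <= _ + X]cnorm_starE -cnormN (le_trans _ (cnormB _ _)) //.
  by rewrite sn /n [X in _ <= cnorm (X - _)]addrC addrKA opprK cnormN.
rewrite -mulr2n -scaler_nat -(rmorph_nat (real_complex R)) cnorm_scaleR normr_nat.
by rewrite cnorm_scale1 ?normCi //; lra.
Qed.

(** [t] is nondecreasing and bounded, hence convergent; telescoping bounds the differences of [s] by
    those of [t], so [s] is Cauchy. *)
Lemma dominated_cvg (s : nat -> A) (t : nat -> R) M :
  (forall n, cnorm (s n.+1 - s n) <= t n.+1 - t n) -> (forall n, t n <= M) ->
  exists l, forall e, 0 < e -> exists N, forall n, (N <= n)%N ->
    cnorm (l - s n) < e.
Proof.
move=> st tM; apply: ccauchy_cvg => e e0.
have stn m k : cnorm (s (m + k)%N - s m) <= t (m + k)%N - t m.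
  elim: k => [|k IH]; first by rewrite addn0 !subrr cnorm0.
  rewrite addnS -(subrKA (s (m + k)%N)) (le_trans (cnormD _ _)) //.
  by have := st (m + k)%N; lra.
have : cvgn t.
  apply: nondecreasing_is_cvgn.
    apply/nondecreasing_seqP => n; rewrite -subr_ge0.
    exact: le_trans (cnorm_ge0 _) (st n).
  by exists M => _ [n _ <-].
move=> /cvgrPdist_lt/(_ (e / 4)); rewrite divr_gt0 // => /(_ isT)[N _ tN].
have sN m : (N <= m)%N -> cnorm (s m - s N) < e / 2.
  move=> Nm; have := stn N (m - N)%N; rewrite subnKC // => sm.
  have := tN m Nm; have := tN N (leqnn N); rewrite !ltr_norml.
  by move=> /andP[??] /andP[??]; lra.
exists N => m n /sN sm /sN sn; rewrite -(subrKA (s N)).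
by rewrite (le_lt_trans (cnormD _ _)) // (cdistC (s N)); lra.
Qed.

(* The square root is 1 - lim s_n with s_(n+1) = (x + s_n^2) / 2; the scalar
   iteration t_n for x = 1 dominates s_n, which covers the boundary case |x| = 1. *)
Lemma sqrt_1sub x : star x = x -> cnorm x <= 1 ->
  exists r, [/\ star r = r, r * r = 1 - x, cnorm (1 - r) <= 1
    & forall C, closed_subalg C -> C x -> C r].
Proof.
move=> sx x1; pose h : R := 2^-1.
pose s := fix s n : A := if n is m.+1 then h%:C *: (x + s m * s m) else 0.
pose t := fix t n : R := if n is m.+1 then h * (1 + t m * t m) else 0.
have sS n : s n.+1 = h%:C *: (x + s n * s n) by [].
have tS n : t n.+1 = h * (1 + t n * t n) by [].
have h0 : 0 < h by rewrite invr_gt0.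
have hh : h + h = 1 by rewrite /h; lra.
have t01 n : 0 <= t n <= 1.
  elim: n => [|n /andP[tn0 tn1]] /=; first by rewrite lexx ler01.
  by apply/andP; split; nra.
have sC n C : closed_subalg C -> C x -> C (s n).
  move=> cC Cx; elim: n => [|n IH] /=.
    by rewrite -(subrr 1); apply: closed_subalgB => //; exact: closed_subalg1.
  apply: closed_subalgZ => //; apply: closed_subalgD => //.
  exact: closed_subalgM.
have xs n : x * s n = s n * x.
  by rewrite (sC n [set y | y * x = x * y]) //; exact: commutant_subalg.
have ss m n : s m * s n = s n * s m.
  by apply: (sC m [set y | y * s n = s n * y]) => //; exact: commutant_subalg.
have nhC y : cnorm (h%:C *: y) = h * cnorm y by rewrite cnorm_scaleR gtr0_norm.
have st n : cnorm (s n) <= t n.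
  elim: n => [|n IH] /=; first by rewrite cnorm0.
  rewrite nhC ler_pM2l // (le_trans (cnormD _ _)) // lerD //.
  by rewrite (le_trans (cnormM _ _)) // ler_pM // cnorm_ge0.
have dst n : cnorm (s n.+1 - s n) <= t n.+1 - t n.
  elim: n => [|n IH].
    have := st 1%N; rewrite [s 0%N]/= [t 0%N]/= !subr0 //.
  have -> : s n.+2 - s n.+1 = h%:C *: ((s n.+1 - s n) * (s n.+1 + s n)).
    rewrite (sS n.+1) [X in _ - X = _]sS -scalerBr; congr (_ *: _); rewrite mulrDr !mulrBl (ss n).
    by rewrite addrA subrK opprD addrACA subrr add0r.
  rewrite nhC.
  have -> : t n.+2 - t n.+1 = h * ((t n.+1 - t n) * (t n.+1 + t n)).
    by rewrite (tS n.+1) [X in _ - X = _]tS; ring.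
  rewrite ler_pM2l // (le_trans (cnormM _ _)) // ler_pM ?cnorm_ge0 //.
  by rewrite (le_trans (cnormD _ _)) // lerD.
have [|l sl] := dominated_cvg (M := 1) dst.
  by move=> n; case/andP: (t01 n).
have sl1 : star l = l.
  apply: (closed_lim closed_selfadj _ sl) => n /=.
  by elim: n => [|n IH] /=; rewrite ?star0 // star_scaleR starD sx starM IH.
have nl1 : cnorm l <= 1.
  apply: (closed_lim (closed_cball (t := 1)) _ sl) => n /=.
  by rewrite (le_trans (st n)) //; case/andP: (t01 n).
have lE : l = h%:C *: (x + l * l).
  apply/subr0_eq/eq0_small => e e0.
  have e2 : 0 < e / 2 by rewrite divr_gt0.
  have [N sN] := sl _ e2.
  rewrite -(subrKA (s N.+1)) (le_trans (cnormD _ _)) //.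
  have := sN N.+1 (leqnSn N); have := sN N (leqnn N) => sN0 sN1.
  have : cnorm (s N.+1 - h%:C *: (x + l * l)) <= e / 2; last by lra.
  have -> : s N.+1 - h%:C *: (x + l * l) =
      h%:C *: ((s N - l) * s N + l * (s N - l)).
    rewrite -scalerBr; congr (_ *: _).
    by rewrite mulrBl mulrBr addrA subrK opprD addrACA subrr add0r.
  rewrite nhC; have : cnorm ((s N - l) * s N + l * (s N - l)) <= e / 2 + e / 2.
    rewrite (le_trans (cnormD _ _)) // lerD // (le_trans (cnormM _ _)) //.
      rewrite -[X in _ <= X]mulr1 ler_pM ?cnorm_ge0 //; first by rewrite cdistC ltW.
      by rewrite (le_trans (st N)) //; case/andP: (t01 N).
    by rewrite -[X in _ <= X]mul1r ler_pM ?cnorm_ge0 // cdistC ltW.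
  by rewrite /h; lra.
(* The fixed-point equation for [l] amounts to [(1 - l)^2 = 1 - x]. *)
have xE : x = l + l - l * l.
  rewrite {1 2}lE -scalerDl -rmorphD hh scale1r addrK //.
exists (1 - l); split.
- by rewrite starB star1 sl1.
- by rewrite xE mulrBr mulr1 mulrBl mul1r !opprD !opprK !addrA.
- by rewrite subKr.
move=> C cC Cx; apply: closed_subalgB => //; first exact: closed_subalg1.
by apply: (closed_lim (closed_subalg_closed cC) _ sl) => n; exact: sC.
Qed.

(** The absolute value of [v] is the square root of [1 - c^2], where [c] is that of [1 - v^2]. The
    bound on [c * c] comes from [v^2 + c^2 = 1] through [cnorm_sqr_le]. *)
Lemma abs_exists v : star v = v -> cnorm v <= 1 ->
  exists a, [/\ star a = a, a * a = v * v, cnorm (1 - a) <= 1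
    & forall C, closed_subalg C -> C v -> C a].
Proof.
move=> sv v1.
have svv : star (v * v) = v * v by rewrite starM sv.
have [|c [sc cc c1 cC]] := sqrt_1sub svv.
  by rewrite (le_trans (cnormM _ _)) // mulr_ile1 // cnorm_ge0.
have sc1 : star (c * c) = c * c by rewrite starM sc.
have [|a [sa aa a1 aC]] := sqrt_1sub sc1.
  rewrite cnorm_selfadj // -(cnorm1 A).
  have -> : (1 : A) = v * v + c * c by rewrite cc subrKC.
  apply: cnorm_sqr_le => //; apply/esym.
  apply: (cC [set y | y * v = v * y]); first exact: commutant_subalg.
  by rewrite /= mulrA.
exists a; split=> //; first by rewrite aa cc subKr.
move=> C cC' Cv; apply: aC => //; rewrite cc.
apply: closed_subalgB => //; first exact: closed_subalg1.
exact: closed_subalgM.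
Qed.

(** The partial sums of the geometric series are dominated by those of the scalar series in
    [rho]. *)
Lemma neumann x rho : cnorm x <= rho -> rho < 1 ->
  exists z, [/\ (1 - x) * z = 1, cnorm z <= (1 - rho)^-1
    & forall C, closed_subalg C -> C x -> C z].
Proof.
move=> xr r1; have r0 := le_trans (cnorm_ge0 x) xr.
pose s := fix s n : A := if n is m.+1 then 1 + x * s m else 0.
pose t := fix t n : R := if n is m.+1 then 1 + rho * t m else 0.
have sS n : s n.+1 = 1 + x * s n by [].
have tS n : t n.+1 = 1 + rho * t n by [].
have r10 : 0 < 1 - rho by lra.
have tM n : t n <= (1 - rho)^-1.
  rewrite -[X in _ <= X]mul1r ler_pdivlMr //; elim: n => [|n IH] /=; first by lra.
  nra.
have dst n : cnorm (s n.+1 - s n) <= t n.+1 - t n.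
  elim: n => [|n IH]; first by rewrite /= !mulr0 !addr0 !subr0 cnorm1.
  have -> : s n.+2 - s n.+1 = x * (s n.+1 - s n).
    by rewrite mulrBr (sS n.+1) [X in _ - X = _]sS opprD addrACA subrr add0r.
  have -> : t n.+2 - t n.+1 = rho * (t n.+1 - t n).
    by rewrite (tS n.+1) [X in _ - X = _]tS; ring.
  by rewrite (le_trans (cnormM _ _)) // ler_pM // cnorm_ge0.
have [l sl] := dominated_cvg dst tM.
have st n : cnorm (s n) <= t n.
  elim: n => [|n IH] /=; first by rewrite cnorm0.
  rewrite (le_trans (cnormD _ _)) // cnorm1 lerD // (le_trans (cnormM _ _)) //.
  by rewrite ler_pM // cnorm_ge0.
exists l; split.
- rewrite mulrBl mul1r; apply/subr0_eq/eq0_small => e e0.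
  have e2 : 0 < e / 2 by rewrite divr_gt0.
  have [N sN] := sl _ e2.
  have -> : l - x * l - 1 = (l - s N.+1) + x * (s N - l).
    by rewrite mulrBr sS opprD !addrA subrK addrAC.
  rewrite (le_trans (cnormD _ _)) //.
  have := sN N.+1 (leqnSn N); have := sN N (leqnn N) => sN0 sN1.
  have := cnormM x (s N - l); rewrite (cdistC (s N)) => xs.
  have : cnorm x * cnorm (l - s N) <= 1 * (e / 2); last by lra.
  by rewrite ler_pM ?cnorm_ge0 //; lra.
- apply: (closed_lim (closed_cball (t := (1 - rho)^-1)) _ sl) => n /=.
  exact: le_trans (st n) (tM n).
move=> C cC Cx; apply: (closed_lim (closed_subalg_closed cC) _ sl).
elim=> [|n IH] /=.
  by rewrite -(subrr 1); apply: closed_subalgB => //; exact: closed_subalg1.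
apply: closed_subalgD => //; first exact: closed_subalg1.
exact: closed_subalgM.
Qed.

End Calculus.

(** * Isometric embeddings *)

Section Isometry.
Context {R : realType}.
Implicit Types A B : cstarType R.

Lemma cstar_closed_subalg A (C : set A) :
  cstar_subalgebra C -> C 1 -> closed_subalg C.
Proof. by move=> [? ? ? ? ? ?] ?. Qed.

(* With w = y^2/t^2 - 1, take g = |w| + w, twice the positive part of w, and
   h = t^-2 (1 + |w|)^-1; then g w = g |w|. *)
Lemma bump A (y : A) (t : R) : star y = y -> 0 < t -> t < cnorm y ->
  exists g h, [/\ g <> 0, cnorm h <= t^-1 ^+ 2, g = g * (y * y) * h
    & forall C, closed_subalg C -> C y -> C g /\ C h].
Proof.
move=> sy t0 ty; pose y' := t^-1%:C *: y.
have ti : 0 < t^-1 by rewrite invr_gt0.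
have sy' : star y' = y' by rewrite star_scaleR sy.
have ny' : 1 < cnorm y'.
  by rewrite cnorm_scaleR gtr0_norm // mulrC -ltr_pdivrMr // mul1r invrK.
have [w w_def] : {w | w = y' * y' - 1} by exists (y' * y' - 1).
pose T := cnorm w + 1.
have T0 : 0 < T by rewrite ltr_wpDl ?cnorm_ge0.
have Ti : 0 < T^-1 by rewrite invr_gt0.
have sw : star w = w by rewrite w_def starB star1 starM sy'.
pose v := T^-1%:C *: w.
have sv : star v = v by rewrite star_scaleR sw.
have nv : cnorm v <= 1.
  by rewrite cnorm_scaleR gtr0_norm // mulrC ler_pdivrMr // mul1r lerDl.
have wE : w = T%:C *: v by rewrite scalerA -rmorphM /= divff ?gt_eqF ?scale1r.
have Cv C : closed_subalg C -> C w -> C v by move=> cC; apply: closed_subalgZ.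
clearbody v.
have [a0 [sa0 aa0 na0 Ca0]] := abs_exists sv nv.
pose a := T%:C *: a0.
have aa : a * a = w * w.
  by rewrite wE /a -!scalerAl -!scalerAr aa0.
have Cw C : closed_subalg C -> C y -> C w.
  move=> cC Cy; rewrite w_def.
  apply: closed_subalgB => //; last exact: closed_subalg1.
  by apply: closed_subalgM => //; apply: closed_subalgZ.
have Ca C : closed_subalg C -> C y -> C a0.
  by move=> cC Cy; apply: Ca0 => //; apply: Cv => //; apply: Cw.
have aw : a * w = w * a.
  rewrite /a -scalerAl -scalerAr; congr (_ *: _).
  apply: (Ca0 [set b | b * w = w * b]); first exact: commutant_subalg.
  by rewrite /= wE -scalerAl -scalerAr.
(* With [a] the absolute value of [w], the element [x] below satisfies [1 + a = (1 + T) (1 - x)], so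
   a Neumann series with ratio [T / (1 + T)] inverts [1 + a]. *)
pose rho := T / (1 + T).
have T1 : 0 < 1 + T by lra.
have rho1 : rho < 1 by rewrite ltr_pdivrMr // mul1r; lra.
have rho0 : 0 < rho by rewrite divr_gt0.
pose x := rho%:C *: (1 - a0).
have nx : cnorm x <= rho.
  by rewrite cnorm_scaleR gtr0_norm // -[X in _ <= X]mulr1 ler_wpM2l // ltW.
have [z [xz nz Cz]] := neumann nx rho1.
have rhoE : (1 - rho)^-1 = 1 + T.
  have -> : 1 - rho = (1 + T)^-1; last by rewrite invrK.
  by rewrite /rho; field; rewrite gt_eqF.
pose h' := (1 + T)^-1%:C *: z.
have ah' : (1 + a) * h' = 1.
  have -> : 1 + a = (1 + T)%:C *: (1 - x).
    rewrite /x scalerBr scalerA -rmorphM /rho mulrC divfK ?gt_eqF //.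
    by rewrite scalerBr rmorphD scalerDl scale1r /a opprB -addrA subrKC.
  by rewrite -scalerAl -scalerAr xz scalerA -rmorphM divff ?scale1r ?gt_eqF.
have nh' : cnorm h' <= 1.
  rewrite cnorm_scaleR gtr0_norm ?invr_gt0 // mulrC ler_pdivrMr // mul1r -rhoE.
  exact: nz.
have Ch' C : closed_subalg C -> C y -> C h'.
  move=> cC Cy; apply: closed_subalgZ => //; apply: Cz => //.
  apply: closed_subalgZ => //; apply: closed_subalgB => //; last exact: Ca.
  exact: closed_subalg1.
clearbody h'.
exists (a + w), ((t^-1 ^+ 2)%:C *: h'); split.
(* If [a + w = 0], then [a = 1 - y'^2]; the square root [b] of [a] satisfies [b^2 + y'^2 = 1], and
   [cnorm_sqr_le] contradicts [1 < cnorm y']. *)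
- move/eqP; rewrite addrC addr_eq0 => /eqP wa.
  have [|k [sk kk _ Ck]] := sqrt_1sub (x := 1 - a0) _ na0.
    by rewrite starB star1 sa0.
  have kcomm : k * y' = y' * k.
    have cy := commutant_subalg y'.
    apply: (Ck _ cy); apply: closed_subalgB => //; first exact: closed_subalg1.
      by apply: Ca => //=; rewrite /y' -scalerAl -scalerAr.
  pose b := (Num.sqrt T)%:C *: k.
  have sb : star b = b by rewrite star_scaleR sk.
  have bb : b * b = 1 - y' * y'.
    rewrite -scalerAl -scalerAr scalerA -rmorphM -expr2 sqr_sqrtr ?ltW //.
    by rewrite kk opprB subrKC -/a -[a]opprK -wa w_def opprB.
  have := @cnorm_sqr_le _ _ b y' sb sy'.
  rewrite bb subrK cnorm1 /b -scalerAl kcomm -scalerAr => /(_ erefl).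
  rewrite leNgt => /negP; apply; nra.
- rewrite cnorm_scaleR ger0_norm ?sqr_ge0 // -[X in _ <= X]mulr1.
  by rewrite ler_wpM2l // sqr_ge0.
- have -> : y * y = (t ^+ 2)%:C *: (1 + w).
    rewrite w_def subrKC /y' -scalerAl -scalerAr !scalerA -!rmorphM.
    have -> : t ^+ 2 * t^-1 * t^-1 = 1 by field; rewrite gt_eqF.
    by rewrite scale1r.
  have tt : (t^-1 ^+ 2)%:C * (t ^+ 2)%:C = 1 :> R[i].
    by rewrite -rmorphM -exprMn mulVf ?gt_eqF // expr1n.
  rewrite -!scalerAr -scalerAl scalerA tt scale1r.
  have -> : (a + w) * (1 + w) = (a + w) * (1 + a).
    by rewrite !mulrDr !mulrDl aa aw [X in _ + X]addrC.
  by rewrite -mulrA ah' mulr1.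
move=> C cC Cy; split.
  apply: closed_subalgD; [done| |exact: Cw].
  by apply: closed_subalgZ => //; exact: Ca.
by apply: closed_subalgZ => //; exact: Ch'.
Qed.

(* If p y < |y| for some selfadjoint y, then [bump] with p y < t < |y| gives
   g = g y^2 h with p h <= t^-2, so p g < p g. *)
Lemma cstar_seminorm_ge A (C : set A) (p : A -> R) :
  cstar_subalgebra C -> C 1 -> (forall x, 0 <= p x) ->
  (forall x y, C x -> C y -> p (x * y) <= p x * p y) ->
  (forall x, C x -> p x <= cnorm x) ->
  (forall x, C x -> p x = 0 -> x = 0) ->
  (forall x, C x -> p (star x * x) <= p x ^+ 2) ->
  forall x, C x -> cnorm x <= p x.
Proof.
move=> sC C1 p0 pM ple pinj pstar.
have cC := cstar_closed_subalg sC C1.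
have psa y : star y = y -> C y -> cnorm y <= p y.
  move=> sy Cy; rewrite leNgt; apply/negP => /midf_lt[]; set t := _ / _.
  move=> pt ty; clearbody t; have t0 : 0 < t by exact: le_lt_trans (p0 y) pt.
  have [g [h [g0 nh gE /(_ C cC Cy)[Cg Ch]]]] := bump sy t0 ty.
  have pg : 0 < p g.
    by rewrite lt0r p0 andbT; apply/eqP => /(pinj _ Cg).
  have Cyy : C (y * y) by exact: closed_subalgM.
  have : p g <= p g * (p y * p y) * t^-1 ^+ 2.
    rewrite {1}gE (le_trans (pM _ _ _ _)) //; first exact: closed_subalgM.
    rewrite ler_pM //; last by rewrite (le_trans (ple _ Ch)).
    by rewrite (le_trans (pM _ _ _ _)) // ler_wpM2l // pM.
  rewrite -mulrA -[X in X <= _]mulr1 ler_pM2l // exprVn ler_pdivlMr ?exprn_gt0 //.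
  by rewrite mul1r -expr2 leNgt ltr_sqr ?nnegrE ?p0 ?ltW // pt.
move=> x Cx; rewrite -ler_sqr ?nnegrE ?cnorm_ge0 // -cnorm_star.
have Cxx : C (star x * x).
  by apply: closed_subalgM => //; exact: cstar_subalgebra_star.
by rewrite (le_trans (psa _ _ Cxx)) ?pstar // starM starK.
Qed.

(* As in [cstar_seminorm_ge] for the distance to J: iterating g = g y^2 h modulo J
   puts g in the closure of J. *)
Lemma dist_ideal_ge A (C J : set A) :
  cstar_subalgebra C -> C 1 -> closed_ideal J -> (forall x, J x -> J (star x)) ->
  (forall x, C x -> J x -> x = 0) ->
  forall y j, C y -> J j -> cnorm y <= cnorm (y - j).
Proof.
move=> sC C1 iJ sJ CJ0; have cC := cstar_closed_subalg sC C1.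
have JN x : J x -> J (- x) by rewrite -scaleN1r; exact: closed_idealZ.
have JB x y : J x -> J y -> J (x - y).
  by move=> Jx /JN; exact: closed_idealD.
have psa y j : star y = y -> C y -> J j -> cnorm y <= cnorm (y - j).
  move=> sy Cy Jj; rewrite leNgt; apply/negP => /midf_lt[]; set t := _ / _.
  move=> pt ty; clearbody t; have t0 : 0 < t by exact: le_lt_trans (cnorm_ge0 _) pt.
  have [g [h [g0 nh gE /(_ C cC Cy)[Cg Ch]]]] := bump sy t0 ty.
  apply: g0; apply: CJ0 => //.
  pose e := y - j; pose r := (cnorm e / t) ^+ 2.
  have yyE : exists2 k, J k & y * y = e * e + k.
    exists (y * j + j * e).
      apply: closed_idealD => //; first exact: closed_idealMl.
      exact: closed_idealMr.
    rewrite addrC -addrA -mulrDl /e (subrKC j) -mulrDr.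
    by rewrite -addrC subrK.
  have [k Jk yyk] := yyE.
  have r1 : r < 1.
    rewrite expr_lt1 ?divr_ge0 ?cnorm_ge0 ?ltW //.
    by rewrite ltr_pdivrMr // mul1r.
  have gJ n : exists2 i, J i & cnorm (g - i) <= cnorm g * r ^+ n.
    elim: n => [|n [i Ji gi]].
      by exists 0; [exact: closed_ideal0|rewrite subr0 expr0 mulr1].
    (* As [g = g y^2 h] and [y^2 = e^2 + k], this choice leaves the error [(g - i) e^2 h], of norm
       at most [r] times that of [g - i]. *)
    exists (i * (y * y) * h + (g - i) * k * h).
      apply: closed_idealD => //; apply: closed_idealMr => //.
        exact: closed_idealMr.
      exact: closed_idealMl.
    have -> : g - (i * (y * y) * h + (g - i) * k * h) = (g - i) * (e * e) * h.
      rewrite {1}gE opprD addrA -!mulrBl yyk -mulrBr; congr (_ * _ * _).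
      by rewrite addrK.
    have rE : r = cnorm e ^+ 2 * t^-1 ^+ 2 by rewrite /r expr_div_n exprVn.
    have -> : cnorm g * r ^+ n.+1 = cnorm g * r ^+ n * cnorm e ^+ 2 * t^-1 ^+ 2.
      by rewrite exprSr [X in _ * (_ * X) = _]rE !mulrA.
    rewrite (le_trans (cnormM _ _)) //.
    rewrite ler_pM ?cnorm_ge0 // (le_trans (cnormM _ _)) //.
    by rewrite ler_pM ?cnorm_ge0 // expr2 cnormM.
  have /closedP cJ := closed_ideal_closed iJ; apply: cJ => eps eps0.
  have [n rn] : exists n, cnorm g * r ^+ n < eps.
    have r_ge0 : 0 <= r by rewrite sqr_ge0.
    have /cvgrPdist_lt/(_ _ eps0)[N _ /(_ N (leqnn N))] :
        (fun n => cnorm g * r ^+ n) @ \oo --> cnorm g * 0.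
      by apply: cvgMr; apply: cvg_expr; rewrite ger0_norm.
    rewrite mulr0 sub0r normrN => rN; exists N.
    exact: le_lt_trans (ler_norm _) rN.
  by have [i Ji gi] := gJ n; exists i => //; exact: le_lt_trans gi rn.
(* Reduction to the selfadjoint case: [star y * y] and [star (y - j) * (y - j)] differ by an element
   of [J]. *)
move=> y j Cy Jj; rewrite -ler_sqr ?nnegrE ?cnorm_ge0 // -!cnorm_star starB.
rewrite mulrBl !mulrBr -addrA -opprD; apply: psa.
- by rewrite starM starK.
- by apply: closed_subalgM => //; exact: cstar_subalgebra_star.
apply: closed_idealD => //; first exact: closed_idealMl.
by apply: JB; apply: closed_idealMr => //; exact: sJ.
Qed.

Lemma cnorm_projection A (q : A) : projection q -> cnorm q <= 1.
Proof.
move=> [qq sq]; have := cnorm_selfadj sq; rewrite qq.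
by have := cnorm_ge0 q; nra.
Qed.

(** * Contractivity and isometry of homomorphisms *)

Section StarHom.
Variables (A B : cstarType R) (f : A -> B).
Hypothesis hf : star_hom f.

Lemma star_homD x y : f (x + y) = f x + f y.
Proof. by have := star_hom_linear hf 1 x y; rewrite !scale1r. Qed.

Lemma star_hom0 : f 0 = 0.
Proof. by apply: (addIr (f 0)); rewrite -star_homD !add0r. Qed.

Lemma star_homZ (c : R[i]) x : f (c *: x) = c *: f x.
Proof. by have := star_hom_linear hf c x 0; rewrite star_hom0 !addr0. Qed.

Lemma star_homB x y : f (x - y) = f x - f y.
Proof. by rewrite star_homD -scaleN1r star_homZ scaleN1r. Qed.

Lemma star_hom_sum (I : Type) (r : seq I) (P : pred I) (F : I -> A) :
  f (\sum_(i <- r | P i) F i) = \sum_(i <- r | P i) f (F i).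
Proof. exact: (big_morph f star_homD star_hom0). Qed.

(* x^2 + c^2 = 1 has a selfadjoint solution c; apply f. *)
Lemma star_hom_contractive x : cnorm (f x) <= cnorm x.
Proof.
have sa y : star y = y -> cnorm y <= 1 -> cnorm (f y) <= 1.
  move=> sy y1.
  have [||c [sc cc _ Cc]] := sqrt_1sub (x := y * y).
  - by rewrite starM sy.
  - by rewrite (le_trans (cnormM _ _)) // mulr_ile1 // cnorm_ge0.
  have cy : c * y = y * c.
    apply: (Cc [set b | b * y = y * b]); first exact: commutant_subalg.
    by rewrite /= mulrA.
  have := @cnorm_sqr_le _ _ (f c) (f y).
  rewrite -!(star_hom_star hf) sc sy -!(star_homM hf) cy => /(_ erefl erefl erefl).
  rewrite -star_homD cc subrK => fy.
  have : cnorm (f 1) <= 1.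
    apply: cnorm_projection; split; rewrite -?(star_homM hf) ?mulr1 //.
    by rewrite -(star_hom_star hf) star1.
  by have := cnorm_ge0 (f y); nra.
have [->|/eqP x0] := eqVneq x 0; first by rewrite star_hom0 !cnorm0.
have nx := cnorm_gt0 x0.
rewrite -ler_sqr ?nnegrE ?cnorm_ge0 // -!cnorm_star.
rewrite -(star_hom_star hf) -(star_homM hf).
have nxx : 0 < cnorm (star x * x) by rewrite cnorm_star exprn_gt0.
pose y := (cnorm (star x * x))^-1%:C *: (star x * x).
have := sa y; rewrite star_scaleR starM starK => /(_ erefl).
rewrite star_homZ !cnorm_scaleR gtr0_norm ?invr_gt0 // mulVf ?gt_eqF //.
by move=> /(_ (lexx _)); rewrite mulrC ler_pdivrMr // mul1r.
Qed.

Lemma closed_star_hom_preimage (X : set B) : closed X -> closed [set x | X (f x)].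
Proof.
apply: (closed_preimage (K := 1)); first exact: star_homB.
by move=> x; rewrite mul1r star_hom_contractive.
Qed.

(** The norm of [f x] is a C*-seminorm on [C] with zero kernel, so [cstar_seminorm_ge] supplies the
    inequality opposite to contractivity. *)
Lemma star_hom_isometry (C : set A) : cstar_subalgebra C -> C 1 ->
  (forall x, C x -> f x = 0 -> x = 0) -> forall x, C x -> cnorm (f x) = cnorm x.
Proof.
move=> sC C1 finj x Cx; apply/eqP; rewrite eq_le star_hom_contractive /=.
apply: (@cstar_seminorm_ge _ C (fun x => cnorm (f x))) => //.
- by move=> ?; exact: cnorm_ge0.
- by move=> a b _ _; rewrite (star_homM hf) cnormM.
- by move=> a _; exact: star_hom_contractive.
- by move=> a Ca /cnorm0_eq0 /finj; apply.
- by move=> a _; rewrite (star_homM hf) (star_hom_star hf) cnorm_star.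
Qed.

End StarHom.

(* The elements s_j = p_i p_j p_i, j != i, sum to 0, and |p_i - 2 s_j| <= 1
   because 1 - 2 p_j is unitary. Hence a small multiple h' of s_j satisfies
   |p_i + h'| <= 1 and |p_i - h'| <= 1, so |p_i + h'^2| <= 1; a square root of
   1 - p_i - h'^2 then shows that - h'^2 is a square in the corner of p_i. *)
Lemma projections_sum1_orthogonal A (I : finType) (p : I -> A) :
  (forall i, projection (p i)) -> \sum_i p i = 1 ->
  forall i j, i != j -> p i * p j = 0.
Proof.
move=> pP p1 i j ij; have [pp sp] := pP i; have [qq sq] := pP j.
have np (k : I) : cnorm (p i - (p i * p k * p i) *+ 2) <= 1.
  have [rr sr] := pP k.
  have -> : p i - (p i * p k * p i) *+ 2 = p i * (1 - p k *+ 2) * p i.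
    by rewrite mulrBr mulrBl mulr1 pp mulrnAr mulrnAl.
  have np := cnorm_projection (pP i).
  have nu : cnorm (1 - p k *+ 2) <= 1.
    have su : star (1 - p k *+ 2) = 1 - p k *+ 2.
      by rewrite starB star1 mulr2n starD sr.
    have uu : (1 - p k *+ 2) * (1 - p k *+ 2) = 1.
      rewrite mulrBl mul1r mulrBr mulr1 mulrnAl mulrnAr rr opprB.
      by rewrite [X in _ + (X - _)]mulr2n addrK subrK.
    have := cnorm_selfadj su; rewrite uu cnorm1 => /esym/eqP.
    by rewrite sqrf_eq1 => /orP[/eqP->//|/eqP->]; lra.
  rewrite (le_trans (cnormM _ _)) // mulr_ile1 ?cnorm_ge0 //.
  by rewrite (le_trans (cnormM _ _)) // mulr_ile1 ?cnorm_ge0.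
pose h := (p i * p j * p i) *+ 2; pose J := [pred k | (k != i) && (k != j)].
pose n : R := #|J|%:R; pose N := n + 1.
have n0 : 0 <= n by rewrite ler0n.
(* Compressing [\sum_k p k = 1] by [p i] shows that the compressions of the [p k] with [k != i] sum
   to 0; those with [k] in [J] add up to minus that of [p j]. *)
have sumh : \sum_(k | J k) (p i - (p i * p k * p i) *+ 2) = n%:C *: p i + h.
  rewrite sumrB sumr_const -[#|_|]/#|J| /n rmorph_nat scaler_nat; congr (_ + _).
  have : p i * (\sum_k p k) * p i = p i by rewrite p1 mulr1 pp.
  rewrite (bigD1 i) //= (bigD1 j) 1?eq_sym //= !mulrDr !mulrDl pp pp.
  rewrite -[X in _ = X]addr0 => /addrI/eqP.
  rewrite addrC addr_eq0 mulr_sumr mulr_suml sumrMnl => /eqP ->.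
  by rewrite mulNrn opprK.
have hn : cnorm (n%:C *: p i + h) <= n.
  rewrite -sumh (le_trans (cnorm_sum _ _ _)) //.
  rewrite (le_trans (ler_sum _ (fun k _ => np k))) // sumr_const.
  by rewrite -[#|_|]/#|J|.
(* With [N = n + 1], both [N (p i + h') = (n p i + h) + p i] and [N (p i - h') = n p i + (p i - h)]
   have norm at most [N]. *)
pose h' := N^-1%:C *: h.
have N0 : 0 < N by rewrite /N; lra.
have Ni : 0 < N^-1 by rewrite invr_gt0.
have sh : star h' = h'.
  by rewrite star_scaleR /h mulr2n starD !starM sp sq mulrA.
have ph : p i * h' = h'.
  by rewrite -scalerAr /h mulrnAr !mulrA pp.
have hp : h' * p i = h' by rewrite -{1}sh -sp -starM ph sh.
have piN : cnorm (p i) <= 1 by exact: cnorm_projection.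
have NpE : n%:C *: p i + p i = N%:C *: p i.
  by rewrite /N rmorphD scalerDl scale1r.
have Nh : h = N%:C *: h' by rewrite scalerA -rmorphM divff ?gt_eqF // scale1r.
clearbody h'.
have NC y : cnorm (N%:C *: y) <= N -> cnorm y <= 1.
  by rewrite cnorm_scaleR gtr0_norm // -[X in _ <= X]mulr1 ler_pM2l.
have hle : cnorm (p i + h') <= 1.
  apply: NC; rewrite scalerDr -NpE -Nh addrAC.
  by rewrite (le_trans (cnormD _ _)) // lerD.
have hge : cnorm (p i - h') <= 1.
  apply: NC; rewrite scalerBr -NpE -Nh -addrA.
  rewrite (le_trans (cnormD _ _)) // lerD //; last exact: np.
  by rewrite cnorm_scaleR ger0_norm // -[X in _ <= X]mulr1 ler_wpM2l.
have hh : cnorm (p i + h' * h') <= 1.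
  have E2 : (p i + h' * h') *+ 2 =
      (p i + h') * (p i + h') + (p i - h') * (p i - h').
    rewrite mulrDl mulrBl !mulrDr !mulrN pp ph hp opprB.
    rewrite [X in _ = X]addrACA [X in _ = X + _]addrACA (addrC h' (h' * h')).
    by rewrite [X in _ = _ + X]addrACA subrr !addr0 addrACA.
  have : cnorm ((p i + h' * h') *+ 2) = 2 * cnorm (p i + h' * h').
    by rewrite -scaler_nat -(rmorph_nat (real_complex R)) cnorm_scaleR normr_nat.
  have le1 (y : A) : cnorm y <= 1 -> cnorm (y * y) <= 1.
    by move=> y1; rewrite (le_trans (cnormM _ _)) // mulr_ile1 ?cnorm_ge0.
  rewrite E2; have := cnormD ((p i + h') * (p i + h')) ((p i - h') * (p i - h')).
  by have := le1 _ hle; have := le1 _ hge; lra.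
have [|r [sr rr _ Cr]] := sqrt_1sub (x := p i + h' * h') _ hh.
  by rewrite starD starM sp sh.
have rp : r * p i = p i * r.
  apply: (Cr [set b | b * p i = p i * b]); first exact: commutant_subalg.
  by rewrite /= mulrDl mulrDr -mulrA hp mulrA ph.
have rh : r * h' = h' * r.
  apply: (Cr [set b | b * h' = h' * b]); first exact: commutant_subalg.
  by rewrite /= mulrDl mulrDr ph hp mulrA.
(* Here [(p i * r)^2 + h'^2 = 0], to which [cnorm_sqr_le] applies. *)
have : cnorm h' ^+ 2 <= 0.
  have := @cnorm_sqr_le _ _ (p i * r) h' _ sh.
  rewrite starM sr sp rp => /(_ erefl).
  rewrite -mulrA rh !mulrA hp ph => /(_ erefl).
  rewrite -(mulrA (p i)) rp mulrA pp -mulrA rr.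
  by rewrite mulrBr mulr1 mulrDr pp mulrA ph opprD addrA subrr add0r addNr cnorm0.
have h'2 := sqr_ge0 (cnorm h').
move=> h'2_le; have h'0 : h' = 0.
  by apply: cnorm0_eq0; apply/eqP; rewrite -sqrf_eq0 eq_le h'2_le.
have pqp : p i * p j * p i = 0.
  move: Nh; rewrite h'0 scaler0 /h -scaler_nat => /eqP.
  by rewrite scaler_eq0 pnatr_eq0 => /eqP.
rewrite -[LHS]starK starM sp sq.
suff -> : p j * p i = 0 by rewrite star0.
apply: cnorm0_eq0; apply/eqP; rewrite -sqrf_eq0 -cnorm_star starM sp sq.
by rewrite mulrA -(mulrA (p i)) qq pqp cnorm0.
Qed.

End Isometry.

(** * Subalgebras *)

Section Subalgebras.
Context {R : realType}.
Implicit Types A B : cstarType R.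

(** Closedness is left out so that increasing unions and images qualify before any closure is
    taken. *)
Record star_subalg A (X : set A) : Prop := StarSubalg {
  star_subalg0 : X 0;
  star_subalgD : forall x y, X x -> X y -> X (x + y);
  star_subalgZ : forall (c : R[i]) x, X x -> X (c *: x);
  star_subalgM : forall x y, X x -> X y -> X (x * y);
  star_subalg_star : forall x, X x -> X (star x)
}.

Lemma cstar_star_subalg A (X : set A) : cstar_subalgebra X -> star_subalg X.
Proof. by case. Qed.

Lemma star_subalg_cstar A (X : set A) :
  star_subalg X -> closed X -> cstar_subalgebra X.
Proof. by case. Qed.

Lemma setT_cstar_subalgebra A : cstar_subalgebra [set: A].
Proof. by split=> //; exact: closedT. Qed.

Lemma star_subalg_sum A (X : set A) (I : Type) (r : seq I) (P : pred I) F :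
  star_subalg X -> (forall i, P i -> X (F i)) -> X (\sum_(i <- r | P i) F i).
Proof.
move=> sX XF; apply: big_ind => //; first exact: star_subalg0.
exact: star_subalgD.
Qed.

Lemma star_subalgN A (X : set A) x : star_subalg X -> X x -> X (- x).
Proof. by move=> sX Xx; rewrite -scaleN1r; exact: star_subalgZ. Qed.

Lemma image_star_subalg A B (f : A -> B) (X : set A) :
  star_hom f -> star_subalg X -> star_subalg (f @` X).
Proof.
move=> hf sX; split.
- by exists 0; [exact: star_subalg0|exact: star_hom0].
- move=> _ _ [x Xx <-] [y Xy <-]; exists (x + y); first exact: star_subalgD.
  exact: star_homD.
- move=> c _ [x Xx <-]; exists (c *: x); first exact: star_subalgZ.
  exact: star_homZ.
- move=> _ _ [x Xx <-] [y Xy <-]; exists (x * y); first exact: star_subalgM.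
  exact: star_homM.
move=> _ [x Xx <-]; exists (star x); first exact: star_subalg_star.
exact: star_hom_star.
Qed.

Lemma cnormZ_le A (c : R[i]) :
  exists2 k : R, 0 <= k & forall x : A, cnorm (c *: x) = k * cnorm x.
Proof.
exists (Num.sqrt (complex.Re c ^+ 2 + complex.Im c ^+ 2)) => [|x].
  exact: sqrtr_ge0.
by apply: complexI; rewrite cnormZ normc_def rmorphM.
Qed.

Lemma cl_cstar_subalgebra A (X : set A) : star_subalg X -> cstar_subalgebra (cl X).
Proof.
move=> sX; split.
- by apply: subset_cl; exact: star_subalg0.
- move=> x y clx cly e e0; have e2 : 0 < e / 2 by rewrite divr_gt0.
  have [x' Xx' xx'] := clx _ e2; have [y' Xy' yy'] := cly _ e2.
  exists (x' + y'); first exact: star_subalgD.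
  by rewrite opprD addrACA (le_lt_trans (cnormD _ _)) //; lra.
- move=> c x clx e e0; have [k k0 ck] := cnormZ_le A c.
  have k1 : 0 < k + 1 by rewrite ltr_wpDl.
  have [x' Xx' xx'] := clx _ (divr_gt0 e0 k1).
  exists (c *: x'); first exact: star_subalgZ.
  rewrite -scalerBr ck; move: xx'; rewrite ltr_pdivlMr //.
  by have := cnorm_ge0 (x - x'); lra.
- move=> x y clx cly e e0.
  have ny : 0 < cnorm y + 1 by rewrite ltr_wpDl ?cnorm_ge0.
  have e2 : 0 < e / 2 by rewrite divr_gt0.
  have [x' Xx' xx'] := clx _ (divr_gt0 e2 ny).
  (* The precision for [y] depends on [x'], because the error is split as
     [(x - x') y + x' (y - y')]. *)
  have nx : 0 < cnorm x' + 1 by rewrite ltr_wpDl ?cnorm_ge0.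
  have [y' Xy' yy'] := cly _ (divr_gt0 e2 nx).
  exists (x' * y'); first exact: star_subalgM.
  rewrite -(subrKA (x' * y)) -mulrBl -mulrBr (le_lt_trans (cnormD _ _)) //.
  have := cnormM (x - x') y; have := cnormM x' (y - y').
  move: xx' yy'; rewrite !ltr_pdivlMr // => xx' yy'.
  have := cnorm_ge0 (x - x'); have := cnorm_ge0 (y - y'); lra.
- move=> x clx e e0; have [x' Xx' xx'] := clx _ e0.
  by exists (star x'); [exact: star_subalg_star|rewrite -starB cnorm_starE].
exact: closed_cl.
Qed.

Lemma bigcup_star_subalg A (X : nat -> set A) :
  (forall n, star_subalg (X n)) -> (forall n, X n `<=` X n.+1) ->
  star_subalg (\bigcup_n X n).
Proof.
move=> sX XS.
have Xle m n : (m <= n)%N -> X m `<=` X n.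
  by move=> /subnKC <-; elim: (n - m)%N => [|k IH]; rewrite ?addn0 ?addnS // => x /IH /XS.
split.
- by exists 0%N => //; exact: star_subalg0.
- move=> x y [m _ Xx] [n _ Xy]; exists (maxn m n) => //.
  by apply: star_subalgD => //; [apply: Xle Xx|apply: Xle Xy]; rewrite ?leq_maxl ?leq_maxr.
- by move=> c x [m _ Xx]; exists m => //; exact: star_subalgZ.
- move=> x y [m _ Xx] [n _ Xy]; exists (maxn m n) => //.
  by apply: star_subalgM => //; [apply: Xle Xx|apply: Xle Xy]; rewrite ?leq_maxl ?leq_maxr.
by move=> x [m _ Xx]; exists m => //; exact: star_subalg_star.
Qed.

(** Preimages in [C] of a sequence converging to [y] form a Cauchy sequence, since [f] preserves
    norms on [C]; [f] maps its limit to [y]. *)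
Lemma closed_image_isometry A B (f : A -> B) (C : set A) :
  star_hom f -> cstar_subalgebra C -> (forall x, C x -> cnorm (f x) = cnorm x) ->
  closed (f @` C).
Proof.
move=> hf sC fC; apply/closedP => y cly.
have Cn n : exists x, C x /\ cnorm (y - f x) < n.+1%:R^-1.
  have [|_ [x Cx <-] yx] := cly n.+1%:R^-1; first by rewrite invr_gt0 ltr0n.
  by exists x.
have [s sP] := choice Cn.
have CB m n : C (s m - s n).
  apply: cstar_subalgebraD => //; first by case: (sP m).
  by apply: star_subalgN; [exact: cstar_star_subalg|case: (sP n)].
have small e : 0 < e -> exists N, forall n, (N <= n)%N -> cnorm (y - f (s n)) < e.
  move=> e0; exists (Num.truncn e^-1) => n Nn.
  have [_ /lt_le_trans] := sP n; apply.
  rewrite -[X in _ <= X]invrK lef_pV2 ?posrE ?ltr0n ?invr_gt0 //.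
  rewrite (le_trans (ltW (truncnS_gt _))) //.
  by rewrite ler_nat ltnS.
have [|x sx] := @ccauchy_cvg R A s.
  move=> e e0; have e2 : 0 < e / 2 by rewrite divr_gt0.
  have [N NP] := small _ e2; exists N => m n /NP ym /NP yn.
  rewrite -fC // (star_homB hf) -(subrKA y) (le_lt_trans (cnormD _ _)) //.
  by rewrite (cdistC (f (s m))); lra.
exists x.
  apply: (closed_lim (cstar_subalgebra_closed sC) _ sx) => n.
  by case: (sP n).
apply/esym/subr0_eq/eq0_small => e e0; have e2 : 0 < e / 2 by rewrite divr_gt0.
have [N NP] := small _ e2; have [N' N'P] := sx _ e2.
rewrite -(subrKA (f (s (maxn N N')))) (le_trans (cnormD _ _)) //.
have := NP _ (leq_maxl N N'); have := N'P _ (leq_maxr N N').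
rewrite -(star_homB hf) => xs ys.
by have := star_hom_contractive hf (s (maxn N N') - x); rewrite (cdistC (s _)); lra.
Qed.

End Subalgebras.

(** * Words and matrices *)

Lemma big_tuple_cons (V : nmodType) (T : finType) k (F : seq T -> V) :
  \sum_(t : k.+1.-tuple T) F t = \sum_(a : T) \sum_(t : k.-tuple T) F (a :: t).
Proof.
rewrite pair_big /=.
rewrite (reindex (fun p : T * k.-tuple T => [tuple of p.1 :: p.2])) //=.
exists (fun t => (thead t, [tuple of behead t])) => [[a t]|t] _ /=.
  by congr (_, _); apply: val_inj.
by apply: val_inj; case: t => -[].
Qed.

Section Words.
Context {R : realType} {A B : cstarType R} {Sigma : finType}.
Variables (rho : Sigma -> A -> A) (iota : A -> B) (S : Sigma -> B).
Hypothesis cov : covariant_family rho iota S.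

Let hom_iota : star_hom iota := covariant_hom cov.

Lemma range_projection a : projection (S a * star (S a)).
Proof.
split; last by rewrite starM starK.
by rewrite mulrA (covariant_isometry cov a).
Qed.

(** The range projections of the [S a] sum to 1, hence are pairwise orthogonal. They commute with
    [iota x], so those of [a] and [b] can be brought next to each other. *)
Lemma letters_orthogonal a b x : a != b -> star (S a) * iota x * S b = 0.
Proof.
move=> ab.
have pab := projections_sum1_orthogonal range_projection (covariant_sum cov) ab.
have [_ sa] := range_projection a.
have eb : S b = S b * star (S b) * S b by rewrite (covariant_isometry cov b).
have ea : star (S a) * S a * star (S a) = star (S a).
  by rewrite -mulrA -sa -starM (covariant_isometry cov a).
transitivity (star (S a) * (S a * star (S a) * (S b * star (S b))) * (iota x * S b)).
  rewrite [in LHS]eb mulrA -(mulrA (star (S a)) (iota x)) (covariant_comm cov).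
  by rewrite !mulrA ea.
by rewrite pab mulr0 mul0r.
Qed.

Notation Sw := (S_word S).

Lemma S_word_nil : Sw [::] = 1.
Proof. by rewrite /S_word big_nil. Qed.

Lemma S_word_cons a mu : Sw (a :: mu) = S a * Sw mu.
Proof. by rewrite /S_word big_cons. Qed.

Lemma S_word_cat mu nu : Sw (mu ++ nu) = Sw mu * Sw nu.
Proof. by rewrite /S_word big_cat. Qed.

Lemma S_word_rcons mu a : Sw (rcons mu a) = Sw mu * S a.
Proof. by rewrite -cats1 S_word_cat S_word_cons S_word_nil mulr1. Qed.

(** Induction on the first letters: the inner factor [star (S a) * iota x * S b] is [iota (rho a x)]
    or 0. *)
Lemma S_word_iota mu nu x : size mu = size nu ->
  star (Sw mu) * iota x * Sw nu = if mu == nu then iota (rho_word rho mu x) else 0.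
Proof.
elim: mu nu x => [|a mu IH] [|b nu] x //= => [_|[mn]].
  by rewrite S_word_nil star1 mul1r mulr1.
transitivity (star (Sw mu) * (star (S a) * iota x * S b) * Sw nu).
  by rewrite !S_word_cons starM !mulrA.
rewrite eqseq_cons; case: eqVneq => [<-|ab] /=.
  by rewrite (covariant_rho cov) IH.
by rewrite letters_orthogonal // mulr0 mul0r.
Qed.

Lemma S_word_orthogonal mu nu : size mu = size nu ->
  star (Sw mu) * Sw nu = if mu == nu then iota (rho_word rho mu 1) else 0.
Proof.
by move=> /S_word_iota <-; rewrite (covariant_unital cov) mulr1.
Qed.

Lemma S_word_sum k : \sum_(mu : k.-tuple Sigma) Sw mu * star (Sw mu) = 1.
Proof.
elim: k => [|k IH].
  rewrite (big_pred1 [tuple]) => [|t]; last by apply/esym/eqP; exact: tuple0.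
  by rewrite S_word_nil star1 mulr1.
rewrite (big_tuple_cons k (fun mu => Sw mu * star (Sw mu))).
rewrite -(covariant_sum cov); apply: eq_bigr => a _.
transitivity (S a * (\sum_(mu : k.-tuple Sigma) Sw mu * star (Sw mu)) * star (S a)).
  rewrite mulr_sumr mulr_suml; apply: eq_bigr => mu _.
  by rewrite S_word_cons starM !mulrA.
by rewrite IH mulr1.
Qed.

(** The matrix expansion of [y]. Row and column words may have different lengths, which is what
    elements of nonzero gauge degree require. *)
Lemma S_word_decomp m k y : y = \sum_(mu : m.-tuple Sigma) \sum_(nu : k.-tuple Sigma)
  Sw mu * (star (Sw mu) * y * Sw nu) * star (Sw nu).
Proof.
transitivity ((\sum_(mu : m.-tuple Sigma) Sw mu * star (Sw mu)) * y *
    (\sum_(nu : k.-tuple Sigma) Sw nu * star (Sw nu))).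
  by rewrite !S_word_sum mul1r mulr1.
rewrite !mulr_suml; apply: eq_bigr => mu _; rewrite mulr_sumr.
by apply: eq_bigr => nu _; rewrite !mulrA.
Qed.

(** The matrices indexed by words of lengths [m] and [k] with entries in [Z]. *)
Definition word_matrix (Z : set B) m k : set B :=
  [set y | forall mu nu, size mu = m -> size nu = k ->
     Z (star (Sw mu) * y * Sw nu)].

Notation M := word_matrix.

Lemma word_matrix_sub (Z Z' : set B) m k : Z `<=` Z' -> M Z m k `<=` M Z' m k.
Proof. by move=> ZZ y My mu nu sm sn; apply: ZZ; exact: My. Qed.

Lemma word_matrix0 Z m k : star_subalg Z -> M Z m k 0.
Proof. by move=> sZ mu nu _ _; rewrite mulr0 mul0r; exact: star_subalg0. Qed.

Lemma word_matrixD Z m k x y : star_subalg Z ->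
  M Z m k x -> M Z m k y -> M Z m k (x + y).
Proof.
move=> sZ Mx My mu nu sm sn; rewrite mulrDr mulrDl.
by apply: star_subalgD => //; [exact: Mx|exact: My].
Qed.

Lemma word_matrixZ Z m k (c : R[i]) x : star_subalg Z ->
  M Z m k x -> M Z m k (c *: x).
Proof.
move=> sZ Mx mu nu sm sn; rewrite -scalerAr -scalerAl.
by apply: star_subalgZ => //; exact: Mx.
Qed.

Lemma word_matrixM Z m k p x y : star_subalg Z ->
  M Z m k x -> M Z k p y -> M Z m p (x * y).
Proof.
move=> sZ Mx My mu nu sm sn.
have -> : star (Sw mu) * (x * y) * Sw nu = \sum_(ka : k.-tuple Sigma)
    (star (Sw mu) * x * Sw ka) * (star (Sw ka) * y * Sw nu).
  transitivity (star (Sw mu) * x * (\sum_(ka : k.-tuple Sigma)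
     Sw ka * star (Sw ka)) * (y * Sw nu)).
    by rewrite S_word_sum mulr1 !mulrA.
  by rewrite mulr_sumr mulr_suml; apply: eq_bigr => ka _; rewrite !mulrA.
apply: star_subalg_sum => // ka _.
by apply: star_subalgM => //; [apply: Mx|apply: My]; rewrite ?size_tuple.
Qed.

Lemma word_matrix_star Z m k x : star_subalg Z -> M Z m k x -> M Z k m (star x).
Proof.
move=> sZ Mx mu nu sm sn.
have -> : star (Sw mu) * star x * Sw nu = star (star (Sw nu) * x * Sw mu).
  by rewrite !starM starK mulrA.
by apply: star_subalg_star => //; exact: Mx.
Qed.

(** Lengthening words by last letters [a] and [b] turns an entry [z] into [star (S a) * z * S b],
    which vanishes for [a != b]. The second set [Z'] leaves room for [rho] to raise the filtration
    index. *)
Lemma word_matrixS (Z Z' : set B) m k : Z `<=` range iota -> Z' 0 ->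
  (forall a z, Z z -> Z' (star (S a) * z * S a)) ->
  M Z m k `<=` M Z' m.+1 k.+1.
Proof.
move=> Zi Z'0 ZZ' y My mu nu.
case/lastP: mu => // mu a; case/lastP: nu => // nu b.
rewrite !size_rcons => -[sm] [sn].
have -> : star (Sw (rcons mu a)) * y * Sw (rcons nu b) =
    star (S a) * (star (Sw mu) * y * Sw nu) * S b.
  by rewrite !S_word_rcons starM !mulrA.
have Mz := My _ _ sm sn.
have [->|ab] := eqVneq a b; first exact: ZZ'.
by have [x _ <-] := Zi _ Mz; rewrite letters_orthogonal.
Qed.

Lemma closed_word_matrix Z m k : closed Z -> closed (M Z m k).
Proof.
move=> cZ; apply/closedP => y cly mu nu sm sn.
have /closedP : closed [set y | Z (star (Sw mu) * y * Sw nu)].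
  apply: (closed_preimage (K := cnorm (star (Sw mu)) * cnorm (Sw nu))) => //.
    by move=> u v; rewrite mulrBr mulrBl.
  move=> u; rewrite (le_trans (cnormM _ _)) // mulrAC ler_wpM2r ?cnorm_ge0 //.
  exact: cnormM.
by apply; apply: cl_subset cly => u; exact.
Qed.

Lemma word_matrix1 Z k : Z 0 ->
  (forall mu, size mu = k -> Z (iota (rho_word rho mu 1))) -> M Z k k 1.
Proof.
move=> Z0 Zr mu nu sm sn; rewrite mulr1 S_word_orthogonal ?sm ?sn //.
by case: eqP => // _; exact: Zr.
Qed.

Lemma word_matrix_cstar Z k : star_subalg Z -> closed Z ->
  cstar_subalgebra (M Z k k).
Proof.
move=> sZ cZ; split.
- exact: word_matrix0.
- by move=> x y; exact: word_matrixD.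
- by move=> c x; exact: word_matrixZ.
- by move=> x y; exact: word_matrixM.
- by move=> x; exact: word_matrix_star.
exact: closed_word_matrix.
Qed.

Lemma word_matrix_eq0 m k y :
  (forall mu nu, size mu = m -> size nu = k -> star (Sw mu) * y * Sw nu = 0) ->
  y = 0.
Proof.
move=> y0; rewrite [y](S_word_decomp m k) big1 // => mu _; rewrite big1 // => nu _.
by rewrite y0 ?size_tuple // mulr0 mul0r.
Qed.

End Words.

(** * Cutting down by a projection of condition (I) *)

Section Cutdown.
Context {R : realType} {A B : cstarType R} {Sigma : finType}.
Variables (rho : Sigma -> A -> A) (iota : A -> B) (S : Sigma -> B).
Hypothesis cov : covariant_family rho iota S.
Notation Sw := (S_word S).
Notation M := (word_matrix S).

(** Multiply by [1 = \sum_nu Sw nu * star (Sw nu)] on the right; only [nu = mu] survives. *)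
Lemma S_word_partial_isometry mu : star (Sw mu) * Sw mu * star (Sw mu) = star (Sw mu).
Proof.
rewrite -[RHS]mulr1 -(S_word_sum cov (size mu)) mulr_sumr.
rewrite (bigD1 (in_tuple mu)) //= mulrA big1 ?addr0 // => nu numu.
rewrite mulrA (S_word_orthogonal cov) ?size_tuple // ifF ?mul0r //.
by apply: contraNF numu => /eqP E; apply/eqP/val_inj.
Qed.

Lemma S_word_inadmissible mu : ~~ admissible rho mu -> Sw mu = 0.
Proof.
rewrite negbK => /eqP r0; rewrite -[Sw mu]starK -S_word_partial_isometry.
rewrite (S_word_orthogonal cov) // eqxx r0 (star_hom0 (covariant_hom cov)).
by rewrite mul0r star0.
Qed.

(** This is [phi_rho] summed over all words; the inadmissible ones contribute 0. *)
Definition word_conj n (q : B) : B :=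
  \sum_(mu : n.-tuple Sigma) Sw mu * q * star (Sw mu).

Lemma phi_rhoE n q : phi_rho rho S n q = word_conj n q.
Proof.
rewrite /phi_rho big_mkcond; apply: eq_bigr => mu _; case: ifPn => // na.
by rewrite S_word_inadmissible // !mul0r.
Qed.

Lemma star_word_conj n q : star q = q -> star (word_conj n q) = word_conj n q.
Proof.
move=> sq; rewrite star_sum; apply: eq_bigr => mu _.
by rewrite !starM starK sq mulrA.
Qed.

Variables (Z : set B) (l : nat).
Hypothesis Zmod : forall mu, (size mu <= l)%N -> Z (iota (rho_word rho mu 1)).

Variable q : B.
Hypothesis qP : projection q.
Hypothesis qZ : forall z, Z z -> q * z = z * q.

(** Only the term [mu = nu] survives, and [star (Sw nu) * Sw nu = iota (rho_word rho nu 1)] lies in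
    [Z], so it commutes with [q]. In matrix terms [word_conj n q] is diagonal with entries [q]. *)
Lemma word_conj_l nu n : (n <= l)%N -> size nu = n ->
  star (Sw nu) * word_conj n q = q * star (Sw nu).
Proof.
move=> nl sn; subst n; rewrite mulr_sumr (bigD1 (in_tuple nu)) //= big1 => [|mu munu].
  have nn := S_word_orthogonal cov (erefl (size nu)); rewrite eqxx in nn.
  rewrite addr0 !mulrA nn -qZ; last exact: Zmod.
  by rewrite -nn -mulrA S_word_partial_isometry.
rewrite !mulrA (S_word_orthogonal cov) ?size_tuple // ifF ?mul0r //.
by apply: contraNF munu => /eqP E; apply/eqP/val_inj.
Qed.

Lemma word_conj_r nu n : (n <= l)%N -> size nu = n ->
  word_conj n q * Sw nu = Sw nu * q.
Proof.
move=> nl sn; have [_ sq] := qP; apply: (can_inj (@starK _ _)).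
by rewrite !starM star_word_conj // sq word_conj_l.
Qed.

Lemma word_conj_projection n : (n <= l)%N -> projection (word_conj n q).
Proof.
have [qq sq] := qP; move=> nl; split; last exact: star_word_conj.
rewrite {1}/word_conj mulr_suml; apply: eq_bigr => mu _.
by rewrite -mulrA word_conj_l ?size_tuple // mulrA -(mulrA _ q q) qq.
Qed.

(** Compare matrix entries: those of [y] lie in [Z] and commute with [q]. *)
Lemma word_conj_comm k y : (k <= l)%N -> M Z k k y ->
  word_conj k q * y = y * word_conj k q.
Proof.
move=> kl My; apply/subr0_eq/(word_matrix_eq0 cov (m := k) (k := k)) => mu nu sm sn.
rewrite mulrBr mulrBl !mulrA word_conj_l //.
rewrite -(mulrA (_ * y)) word_conj_r // mulrA -(mulrA q) -(mulrA q).
by rewrite qZ ?subrr //; exact: My.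
Qed.

(** Split the row words as [mu ++ ka]. The entries of [y] commute with [q], leaving the factor [q *
    Sw ka * q = q * word_conj n q * Sw ka = 0]. *)
Lemma word_conj_off_diag k n y : (k <= l)%N -> star_subalg Z ->
  (n <= l)%N -> q * word_conj n q = 0 -> M Z (k + n)%N k y ->
  word_conj k q * y * word_conj k q = 0.
Proof.
move=> kl sZ nl qn My; apply: (word_matrix_eq0 cov (m := k) (k := k)) => mu nu sm sn.
rewrite -!mulrA word_conj_r // !mulrA word_conj_l //.
have -> : q * star (Sw mu) * y * Sw nu * q = \sum_(ka : n.-tuple Sigma)
    q * Sw ka * (star (Sw (mu ++ ka)) * y * Sw nu) * q.
  transitivity (q * (\sum_(ka : n.-tuple Sigma) Sw ka * star (Sw ka)) *
     (star (Sw mu) * y * Sw nu) * q).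
    by rewrite (S_word_sum cov) mulr1 !mulrA.
  rewrite mulr_sumr !mulr_suml; apply: eq_bigr => ka _.
  by rewrite S_word_cat starM !mulrA.
rewrite big1 // => ka _.
rewrite -mulrA -qZ; last by apply: My; rewrite ?size_cat ?sm ?size_tuple.
by rewrite mulrA -(mulrA q) -(word_conj_r nl (size_tuple ka)) !mulrA qn !mul0r.
Qed.

(** The projection commutes with the matrix algebra, so the norm of its product with [y] is a
    C*-seminorm there. It has zero kernel because multiplication by [q] is injective on entries;
    [cstar_seminorm_ge] concludes. *)
Lemma word_conj_isometry k y : (k <= l)%N -> star_subalg Z -> closed Z ->
  (forall z, Z z -> q * z = 0 -> z = 0) -> M Z k k y ->
  cnorm y <= cnorm (word_conj k q * y).
Proof.
move=> kl sZ cZ qinj; have [QQ sQ] := word_conj_projection kl.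
set Q := word_conj k q in QQ sQ *.
have sC : cstar_subalgebra (M Z k k) by exact: (word_matrix_cstar cov).
have Qc x : M Z k k x -> Q * x = x * Q by exact: word_conj_comm.
apply: (cstar_seminorm_ge (p := fun y => cnorm (Q * y)) sC).
- apply: (word_matrix1 cov); first exact: star_subalg0.
  by move=> mu sm; apply: Zmod; rewrite sm.
- by move=> x; exact: cnorm_ge0.
- by move=> a b Ca Cb; rewrite -{1}QQ -mulrA (mulrA Q a) (Qc a) // -mulrA mulrA Qc // cnormM.
- move=> x _; rewrite (le_trans (cnormM _ _)) // -[X in _ <= X]mul1r.
  by rewrite ler_wpM2r ?cnorm_ge0 // cnorm_projection //; exact: word_conj_projection.
- move=> x Cx /cnorm0_eq0 Qx.
  apply: (word_matrix_eq0 cov (m := k) (k := k)) => mu nu sm sn.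
  apply: qinj; first exact: Cx.
  by rewrite !mulrA -(word_conj_l kl sm) -/Q -(mulrA _ _ x) Qx mulr0 mul0r.
move=> x Cx; rewrite -cnorm_star starM sQ Qc.
  by rewrite -mulrA -Qc // -{1}QQ !mulrA.
by apply: (cstar_subalgebraM sC) => //; exact: (cstar_subalgebra_star sC).
Qed.

End Cutdown.

(** * The core and homogeneous elements *)

Lemma dense_cl (R : realType) (A : cstarType R) (X : set A) : dense X -> cl X = setT.
Proof.
move=> dX; apply/seteqP; split=> // x _ e e0.
have xe : nbhs x [set y | cnorm (x - y) < e] by apply/nbhs_cnorm; exists e.
have [||y [/interior_subset /= xy Xy]] := dX (interior [set y | cnorm (x - y) < e]).
- by exists x.
- exact: open_interior.
by exists y.
Qed.

Lemma cl_min (R : realType) (A : cstarType R) (X Y : set A) :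
  closed Y -> X `<=` Y -> cl X `<=` Y.
Proof. by move=> /closedP cY XY x clx; apply: cY; exact: cl_subset clx. Qed.

Section Core.
Context {R : realType} {A B : cstarType R} {Sigma : finType}.
Variables (rho : Sigma -> A -> A) (iota : A -> B) (S : Sigma -> B).
Hypothesis cov : covariant_family rho iota S.
Hypothesis iota_isometry : forall x, cnorm (iota x) = cnorm x.
Notation Sw := (S_word S).
Notation M := (word_matrix S).
Notation Z := (range iota).

Let hom_iota : star_hom iota := covariant_hom cov.

Lemma range_iota_cstar : cstar_subalgebra Z.
Proof.
have sT := @setT_cstar_subalgebra R A.
apply: star_subalg_cstar.
  by apply: image_star_subalg => //; exact: cstar_star_subalg.
by apply: closed_image_isometry.
Qed.

Let sZ : star_subalg Z := cstar_star_subalg range_iota_cstar.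

Lemma range_matrix_lift m k i : M Z m k `<=` M Z (m + i)%N (k + i)%N.
Proof.
elim: i => [|i IH]; first by rewrite !addn0.
rewrite !addnS => y /IH; apply: (word_matrixS cov) => //; first exact: star_subalg0.
by move=> a _ [x _ <-]; exists (rho a x) => //; rewrite (covariant_rho cov).
Qed.

Lemma S_word_matrix mu : M Z (size mu) 0 (Sw mu).
Proof.
move=> nu [|//] sn _; rewrite S_word_nil mulr1 (S_word_orthogonal cov) //.
by case: eqP => _; [eexists|exact: star_subalg0].
Qed.

(** The fixed-point algebra of the gauge action. *)
Definition core : set B := cl (\bigcup_k M Z k k).

Lemma core_cstar : cstar_subalgebra core.
Proof.
apply: cl_cstar_subalgebra; apply: bigcup_star_subalg => k.
  apply: cstar_star_subalg; apply: (word_matrix_cstar cov) => //.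
  exact: cstar_subalgebra_closed range_iota_cstar.
by have := @range_matrix_lift k k 1; rewrite !addn1.
Qed.

(** Conjugation by [Sw mu] is continuous and sends matrices over words of length [k] to matrices
    over words of length [size mu + k]. *)
Lemma word_conj_core n q : core q -> core (word_conj S n q).
Proof.
move=> Fq; apply: star_subalg_sum => [|mu _]; first exact: cstar_star_subalg core_cstar.
suff : core `<=` [set y | core (Sw mu * y * star (Sw mu))] by apply.
apply: cl_min.
  apply: (closed_preimage (K := cnorm (Sw mu) * cnorm (star (Sw mu)))).
  - by move=> x y; rewrite mulrBr mulrBl.
  - move=> x; rewrite (le_trans (cnormM _ _)) // mulrAC ler_wpM2r ?cnorm_ge0 //.
    exact: cnormM.
  - exact: closed_cl.
move=> y [k _ My]; apply: subset_cl; exists (size mu + k)%N => //.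
have Mmu : M Z (size mu + k)%N k (Sw mu).
  by have := @range_matrix_lift _ _ k _ (@S_word_matrix mu).
apply: (word_matrixM cov sZ _ (word_matrix_star sZ Mmu)).
exact: (word_matrixM cov sZ Mmu My).
Qed.

Lemma D_rho_core : D_rho rho iota S `<=` core.
Proof.
move=> x; apply; split; first exact: core_cstar.
move=> _ [mu [a [_ ->]]]; apply: subset_cl; exists (size mu) => //.
have Mmu := @S_word_matrix mu.
apply: (word_matrixM cov sZ _ (word_matrix_star sZ Mmu)).
apply: (word_matrixM cov sZ Mmu) => nu ka /size0nil-> /size0nil->.
by rewrite S_word_nil star1 mul1r mulr1; exists a.
Qed.

(** The matrix entries of an element of [J] are again in [J], so each matrix algebra meets [J] only
    in 0 and [dist_ideal_ge] applies; the bound passes to the closure. *)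
Lemma core_dist_ideal (J : set B) : closed_ideal J -> (forall x, J x -> J (star x)) ->
  (forall x, J (iota x) -> x = 0) ->
  forall y j, core y -> J j -> cnorm y <= cnorm (y - j).
Proof.
move=> iJ sJ Jiota y j Fy Jj.
suff : core `<=` [set y | cnorm y <= cnorm (y - j)] by apply.
apply: cl_min => [|{Fy}y [k _ My]].
  apply/closedP => x clx /=; apply/ler_addgt0Pr => e e0.
  have e2 : 0 < e / 2 by rewrite divr_gt0.
  have [x' /= x'j xx'] := clx _ e2.
  have := cnormD (x - x') x'; rewrite subrK.
  have := cnormD (x' - x) (x - j); rewrite subrKA (cdistC x'); lra.
have cZ := cstar_subalgebra_closed range_iota_cstar.
have sC : cstar_subalgebra (M Z k k) by exact: (word_matrix_cstar cov).
apply: (dist_ideal_ge sC _ iJ sJ) => // [|x Mx Jx].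
  apply: (word_matrix1 cov); first exact: star_subalg0.
  by move=> mu _; eexists.
apply: (word_matrix_eq0 cov (m := k) (k := k)) => mu nu sm sn.
have [a _ aE] := Mx _ _ sm sn.
have : J (star (Sw mu) * x * Sw nu).
  by apply: closed_idealMr => //; exact: closed_idealMl.
by rewrite -aE => /Jiota ->; rewrite star_hom0.
Qed.

End Core.

(** * Homogeneous components and their distance to an ideal *)

Section Homogeneous.
Context {R : realType} {A B : cstarType R} {Sigma : finType}.
Variables (rho : Sigma -> A -> A) (iota : A -> B) (S : Sigma -> B).
Hypothesis cov : covariant_family rho iota S.
Notation Sw := (S_word S).
Notation M := (word_matrix S).

Variable Al : nat -> set A.
Hypothesis Al_cstar : forall l, cstar_subalgebra (Al l).
Hypothesis Al1 : forall l, Al l 1.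
Hypothesis Al_incr : forall l, Al l `<=` Al l.+1.
Hypothesis Al_rho : forall l a, rho a @` Al l `<=` Al l.+1.

Let hom_iota : star_hom iota := covariant_hom cov.
Let Z l := iota @` Al l.

Lemma filtration_mono l l' : (l <= l')%N -> Al l `<=` Al l'.
Proof.
move=> /subnKC <-; elim: (l' - l)%N => [|k IH]; first by rewrite addn0.
by rewrite addnS => x /IH /Al_incr.
Qed.

Lemma filtration_star_subalg l : star_subalg (iota @` Al l).
Proof. by apply: image_star_subalg => //; exact: cstar_star_subalg. Qed.

Let sZ := filtration_star_subalg.

Lemma filtration_rho_word mu l : (size mu <= l)%N -> Al l (rho_word rho mu 1).
Proof.
elim/last_ind: mu l => [|mu a IH] l; first by move=> _; exact: Al1.
rewrite size_rcons; case: l => // l; rewrite ltnS => /IH mul.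
by rewrite /rho_word foldl_rcons; apply: Al_rho; exists (rho_word rho mu 1) => //.
Qed.

Lemma filtration_matrix_lift m k l i : M (Z l) m k `<=` M (Z (l + i)%N) (m + i)%N (k + i)%N.
Proof.
elim: i => [|i IH]; first by rewrite !addn0.
rewrite !addnS => y /IH; apply: (word_matrixS cov).
- by move=> _ [x _ <-]; exists x.
- exact: star_subalg0 (sZ _).
move=> a _ [x Ax <-]; exists (rho a x); first by apply: Al_rho; exists x.
by rewrite (covariant_rho cov).
Qed.

(** Degree [n] for the gauge action. A homogeneous element of the algebra generated
    by the S_a and the images of the [Al l] lies in all [word_matrix] spaces of
    difference [n] whose sizes and filtration index are large enough. *)
Definition homogeneous (n : int) (y : B) : Prop :=
  exists N, forall m k L, (N <= m)%N -> (N <= k)%N -> (N + m + k <= L)%N ->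
    m%:Z - k%:Z = n -> word_matrix S (iota @` Al L) m k y.

Lemma matrix_homogeneous m k l y : M (Z l) m k y -> homogeneous (m%:Z - k%:Z) y.
Proof.
(* This threshold makes [m <= m'] and [k <= k'], and lets [L] absorb the [i] filtration steps of the
   lift. *)
move=> My; exists (l + m + k)%N => m' k' L mm' kk' mkL mk.
pose i := (m' - m)%N.
have -> : m' = (m + i)%N by rewrite /i; lia.
have -> : k' = (k + i)%N by rewrite /i; lia.
apply: (@word_matrix_sub _ _ _ S (Z (l + i)%N)); last exact: filtration_matrix_lift.
by move=> _ [x Ax <-]; exists x => //; apply: filtration_mono Ax; rewrite /i; lia.
Qed.

Lemma homogeneous0 n : homogeneous n 0.
Proof. by exists 0%N => m k L _ _ _ _; exact: word_matrix0 (sZ _). Qed.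

Lemma homogeneousD n x y : homogeneous n x -> homogeneous n y -> homogeneous n (x + y).
Proof.
move=> [N xN] [N' yN]; exists (N + N')%N => m k L Nm Nk NL mk.
by apply: (word_matrixD (sZ _)) => //; [apply: xN|apply: yN] => //; lia.
Qed.

Lemma homogeneousZ n (c : R[i]) x : homogeneous n x -> homogeneous n (c *: x).
Proof. by move=> [N xN]; exists N => m k L *; apply: (word_matrixZ _ (sZ _)) => //; exact: xN. Qed.

Lemma homogeneous_sum n (I : Type) (r : seq I) (P : pred I) F :
  (forall i, P i -> homogeneous n (F i)) -> homogeneous n (\sum_(i <- r | P i) F i).
Proof. move=> Fn; apply: big_ind => //; [exact: homogeneous0|exact: homogeneousD]. Qed.

Lemma homogeneous_star n x : homogeneous n x -> homogeneous (- n) (star x).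
Proof.
move=> [N xN]; exists N => m k L Nm Nk NL mk.
by apply: (word_matrix_star (sZ _)) => //; apply: xN => //; lia.
Qed.

Lemma homogeneousM n n' x y :
  homogeneous n x -> homogeneous n' y -> homogeneous (n + n') (x * y).
Proof.
(* The inner size is [p = m - n = k + n']; the summands [|n|] and [|n'|] keep it above both
   thresholds and within the filtration bound. *)
move=> [N xN] [N' yN]; exists (N + N' + `|n| + `|n'|)%N => m k L Nm Nk NL mk.
have [p pE] : exists p : nat, p%:Z = m%:Z - n by exists `|m%:Z - n|%N; lia.
by apply: (word_matrixM cov (sZ _) (k := p)) => //; [apply: xN|apply: yN]; lia.
Qed.

Lemma homogeneous_iota l a : Al l a -> homogeneous 0 (iota a).
Proof.
move=> Aa; rewrite -(subrr (0%N : int)); apply: (@matrix_homogeneous _ _ l).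
move=> mu nu /size0nil -> /size0nil ->.
by rewrite S_word_nil star1 mul1r mulr1; exists a.
Qed.

Lemma homogeneous_S a : homogeneous 1 (S a).
Proof.
rewrite -[1]/(1%:Z - 0%:Z); apply: (@matrix_homogeneous _ _ 1).
move=> [|b[]] // nu _ /size0nil ->.
have -> : S a = Sw [:: a] by rewrite S_word_cons S_word_nil mulr1.
rewrite S_word_nil mulr1 (S_word_orthogonal cov) //.
case: eqP => _; last exact: star_subalg0 (sZ _).
by exists (rho_word rho [:: b] 1) => //; exact: filtration_rho_word.
Qed.

Lemma homogeneous_seq (s : seq (int * B)) : (forall t, t \in s -> homogeneous t.1 t.2) ->
  exists N, forall t, t \in s -> (`|t.1| <= N)%N /\
    forall m k L, (N <= m)%N -> (N <= k)%N -> (N + m + k <= L)%N ->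
    m%:Z - k%:Z = t.1 -> M (Z L) m k t.2.
Proof.
elim: s => [|t s IH] st; first by exists 0%N.
have [|N NP] := IH; first by move=> u us; apply: st; rewrite inE us orbT.
have [N' N'P] := st _ (mem_head _ _).
exists (N + N' + `|t.1|)%N => u; rewrite inE => /orP[/eqP->|/NP[uN uP]].
  split=> [|m k L Nm Nk NL mk]; first exact: leq_addl.
  by apply: N'P => //; lia.
split=> [|m k L Nm Nk NL mk]; last by apply: uP => //; lia.
by rewrite (leq_trans uN) // -addnA leq_addr.
Qed.

Hypothesis condI : forall k l : nat, (0 < k)%N -> (k <= l)%N ->
  exists q : B, [/\ D_rho rho iota S q, projection q,
    (forall a, Al l a -> q * iota a = iota a * q),
    (forall a, Al l a -> a <> 0 -> q * iota a <> 0)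
    & (forall m, (1 <= m <= k)%N -> q * phi_rho rho S m q = 0)].
Hypothesis Al_dense : dense (\bigcup_l Al l).

(** The nonvanishing clause of condition (I) makes [iota] injective, hence isometric, on each
    [Al l]; density extends this to all of [A]. *)
Lemma iota_isometry x : cnorm (iota x) = cnorm x.
Proof.
have Aiso l a : Al l a -> cnorm (iota a) = cnorm a.
  apply: star_hom_isometry => // b Ab ib0.
  (* Condition (I) concerns positive indices only, so the projection is taken at level [l.+1]. *)
  have [q [_ _ _ qinj _]] := condI (ltn0Sn 0) (ltn0Sn l).
  have [//|/eqP b0] := eqVneq b 0.
  by case: (qinj b) => //; [exact: Al_incr|rewrite ib0 mulr0].
apply/eqP; rewrite eq_le star_hom_contractive //=.
apply/ler_addgt0Pr => e e0; have e2 : 0 < e / 2 by rewrite divr_gt0.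
have : cl (\bigcup_l Al l) x by rewrite dense_cl.
move=> /(_ _ e2)[a [l _ Aa] xa].
have := star_hom_contractive hom_iota (x - a); rewrite (star_homB hom_iota).
have := cnormD (x - a) a; rewrite subrK -(Aiso l a) //.
have := cnormB (iota x) (iota x - iota a); rewrite subKr; lra.
Qed.

Let cZ l : closed (Z l).
Proof. by apply: closed_image_isometry => // x _; exact: iota_isometry. Qed.

Variable J : set B.
Hypothesis iJ : closed_ideal J.
Hypothesis sJ : forall x, J x -> J (star x).
Hypothesis Jiota : forall x, J (iota x) -> x = 0.

Lemma degree0_dist_ideal (s : seq (int * B)) x :
  (forall t, t \in s -> homogeneous t.1 t.2) -> J x ->
  cnorm (\sum_(t <- s | t.1 == 0) t.2) <= cnorm (\sum_(t <- s) t.2 - x).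
Proof.
move=> sP Jx; have [N NP] := homogeneous_seq sP.
(* All degrees are at most [N] in absolute value, so [q] must be orthogonal to its first [N] shifts;
   [k = N + 1] is moreover positive. The index [l] accommodates the entries of matrices of sizes [k]
   and [k + n] with [n <= N]. *)
pose k := N.+1; pose l := (N + k + k + N)%N.
have kl : (k <= l)%N by rewrite /l; lia.
have [q [Dq qP qcomm qinj qphi]] := condI (ltn0Sn N) kl.
have qZ z : Z l z -> q * z = z * q by case=> a Aa <-; exact: qcomm.
have Zmod mu : (size mu <= l)%N -> Z l (iota (rho_word rho mu 1)).
  by move=> mul; exists (rho_word rho mu 1) => //; exact: filtration_rho_word.
have [QQ sQ] := word_conj_projection cov Zmod qP qZ kl.
set Q := word_conj S k q in QQ sQ.
have nQ : cnorm Q <= 1 by exact: cnorm_projection.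
have off n y : (0 < n)%N -> (n <= N)%N -> M (Z l) (k + n)%N k y -> Q * y * Q = 0.
  move=> n0 nN; apply: (word_conj_off_diag cov Zmod qP qZ kl (sZ l)).
    by rewrite /l /k; lia.
  by rewrite -(phi_rhoE cov) qphi // n0 /k; lia.
set p0 := \sum_(t <- s | t.1 == 0) t.2.
have Mp0 : M (Z l) k k p0.
  rewrite /p0 big_seq_cond; apply: big_ind.
  - exact: word_matrix0 (sZ _).
  - by move=> ? ?; exact: word_matrixD (sZ _).
  move=> t /andP[/NP[_ tP] /eqP t0].
  by apply: tP; rewrite ?subrr ?t0 //; rewrite /l /k; lia.
have QpQ : Q * (\sum_(t <- s) t.2) * Q = Q * p0.
  have -> : Q * p0 = Q * p0 * Q.
    by rewrite (word_conj_comm cov Zmod qP qZ kl Mp0) -mulrA QQ.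
  have sumQ (P : pred (int * B)) :
      Q * (\sum_(t <- s | P t) t.2) * Q = \sum_(t <- s | P t) Q * t.2 * Q.
    by move: (Q) => Q'; rewrite mulr_sumr mulr_suml.
  rewrite !sumQ [RHS]big_mkcond big_seq [RHS]big_seq.
  apply: eq_bigr => -[n y] /NP[/= nN nP]; case: ifPn => // n0.
  (* Positive degrees are killed by [off], negative ones by [off] applied to the adjoint. *)
  case: (ltgtP n 0) n0 => // n0 _.
    have My : M (Z l) k (k + `|n|)%N y by apply: nP; rewrite /l /k; lia.
    apply: (can_inj (@starK _ _)).
    rewrite star0 !starM sQ mulrA (off `|n|%N) //; first by lia.
    exact: word_matrix_star (sZ _) _.
  by apply: (off `|n|%N) => //; [lia|apply: nP; rewrite /l /k; lia].
have p0Q : cnorm p0 <= cnorm (Q * p0).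
  apply: (word_conj_isometry cov Zmod qP qZ kl (sZ l) (@cZ l)) => // z [a Aa <-] qa.
  have [->|/eqP a0] := eqVneq a 0; first by rewrite star_hom0.
  by case: (qinj a).
have FQp0 : core iota S (Q * p0).
  apply: (cstar_subalgebraM (core_cstar cov iota_isometry)).
    by apply: (word_conj_core cov iota_isometry); exact: (D_rho_core cov iota_isometry).
  apply: subset_cl; exists k => //; apply: word_matrix_sub Mp0 => _ [a _ <-].
  by exists a.
have JQ : J (Q * x * Q) by apply: closed_idealMr => //; exact: closed_idealMl.
apply: (le_trans p0Q).
apply: (le_trans (core_dist_ideal cov iota_isometry iJ sJ Jiota FQp0 JQ)).
rewrite -QpQ -mulrBl -mulrBr (le_trans (cnormM _ _)) //.
rewrite -[X in _ <= X]mulr1 ler_pM ?cnorm_ge0 // (le_trans (cnormM _ _)) //.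
by rewrite -[X in _ <= X]mul1r ler_wpM2r ?cnorm_ge0.
Qed.

(** Multiplying by the adjoint of the component [z] moves degree [n] to degree 0, where the
    component becomes [star z * z], of norm [cnorm z ^+ 2]; then divide by [cnorm z]. *)
Lemma degree_dist_ideal (s : seq (int * B)) x n :
  (forall t, t \in s -> homogeneous t.1 t.2) -> J x ->
  cnorm (\sum_(t <- s | t.1 == n) t.2) <= cnorm (\sum_(t <- s) t.2 - x).
Proof.
move=> sP Jx; set z := \sum_(t <- s | _) _.
have zn : homogeneous n z.
  rewrite /z big_seq_cond; apply: homogeneous_sum => t /andP[/sP + /eqP <-] //.
have := @degree0_dist_ideal [seq (t.1 - n, star z * t.2) | t <- s] (star z * x).
rewrite !big_map /=.
rewrite (eq_bigl (fun t : int * B => t.1 == n)) => [|t]; last by rewrite subr_eq0.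
rewrite -!mulr_sumr -mulrBr cnorm_star => le.
have [z0|z0] := eqVneq (cnorm z) 0; first by rewrite z0 cnorm_ge0.
have zgt0 : 0 < cnorm z by rewrite lt0r z0 cnorm_ge0.
rewrite -(ler_pM2l zgt0) -expr2 (le_trans (le _ _)) //.
- move=> _ /mapP[t ts ->] /=; rewrite addrC.
  by apply: homogeneousM; [exact: homogeneous_star|exact: sP].
- exact: closed_idealMl.
by rewrite (le_trans (cnormM _ _)) // cnorm_starE.
Qed.

End Homogeneous.

(** * Gauge action and Fejer means *)

(** [X^n - 1] splits and is separable in characteristic 0, so it has [n] distinct roots, one of them
    primitive. *)
Lemma prim_root_exists (F : numClosedFieldType) n :
  (0 < n)%N -> exists z : F, n.-primitive_root z.
Proof.
move=> n0; have [r rE] := closed_field_poly_normal ('X^n - 1 : {poly F}).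
rewrite lead_coefXnsubC // scale1r in rE.
have /hasP[z _ zn] : has n.-primitive_root r.
  apply: has_prim_root => //.
  - by apply/allP => z; rewrite /root_of_unity rE root_prod_XsubC.
  - by rewrite -separable_prod_XsubC -rE separable_Xn_sub_1 // pnatr_eq0 -lt0n.
  by rewrite -ltnS -(size_prod_XsubC r id) -rE size_XnsubC.
by exists z.
Qed.

Lemma norm_prim_root (F : numClosedFieldType) n (z : F) :
  (0 < n)%N -> n.-primitive_root z -> `|z| = 1.
Proof.
move=> n0 zn; apply/eqP; rewrite -(pexpr_eq1 n0) ?normr_ge0 // -normrX.
by rewrite (prim_expr_order zn) normr1.
Qed.

Lemma eq_mod_small n p q : (`|p%:Z - q%:Z| < n)%N -> (p == q %[mod n]) = (p == q).
Proof.
wlog qp : p q / (q <= p)%N => [H pq|pq].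
  have [qp|/ltnW pq'] := leqP q p; first exact: H.
  by rewrite eq_sym [RHS]eq_sym; apply: H => //; lia.
rewrite eqn_mod_dvd //; apply/idP/eqP => [|->]; last by rewrite subnn dvdn0.
have [|pq0 /dvdn_leq] := posnP (p - q)%N; first by lia.
by move=> /(_ pq0); lia.
Qed.

Lemma sum_ord_eq N c k : (\sum_(b < N) (c == b + k) = (k <= c < k + N))%N.
Proof.
elim: N => [|N IH]; first by rewrite big_ord0 addn0; case: ltngtP.
by rewrite big_ord_recr /= IH; lia.
Qed.

(** These lengths of the diagonals of an [N] by [N] matrix are the coefficients of the Fejer kernel,
    up to the factor [N]. *)
Lemma count_diagonal N m k :
  (\sum_(a < N) \sum_(b < N) (a + m == b + k) = N - `|m%:Z - k%:Z|)%N.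
Proof.
under eq_bigr => a _ do rewrite sum_ord_eq.
have step n : (\sum_(a < n) (k <= a + m < k + N) =
    minn (m + n) (k + N) - maxn k m)%N.
  elim: n => [|n IH]; first by rewrite big_ord0; lia.
  by rewrite big_ord_recr /= IH; lia.
by rewrite step; lia.
Qed.

Section Gauge.
Context {R : realType} {A B : cstarType R} {Sigma : finType}.
Variables (rho : Sigma -> A -> A) (iota : A -> B) (S : Sigma -> B).
Hypothesis cp : is_crossed_product rho iota S.
Notation M := (word_matrix S).

Let cov := crossed_product_covariant cp.

Lemma gauge_covariant (z : R[i]) : `|z| = 1 -> covariant_family rho iota (fun a => z *: S a).
Proof.
move=> z1; have zz : z * Num.conj z = 1 by rewrite -normCK z1 expr1n.
have SS a x : z *: S a * x * star (z *: S a) = S a * x * star (S a).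
  by rewrite starZ -!scalerAl -scalerAr scalerA zz scale1r.
have SS1 a : z *: S a * star (z *: S a) = S a * star (S a).
  by have := SS a 1; rewrite !mulr1.
split.
- exact: covariant_hom cov.
- exact: covariant_unital cov.
- by move=> a; rewrite /partial_isometry SS1 -scalerAr (covariant_isometry cov).
- by rewrite -(covariant_sum cov); apply: eq_bigr => a _; exact: SS1.
- move=> a x; rewrite starZ -!scalerAl -scalerAr scalerA mulrC zz scale1r.
  exact: (covariant_rho cov).
by move=> a x; rewrite SS1; exact: (covariant_comm cov).
Qed.

(** Universality, applied to the family [z *: S a], provides [g]. The factor is [z] to the power
    [m - k], written with natural exponents by means of the conjugate. *)
Lemma gauge_action (z : R[i]) : `|z| = 1 -> exists g : B -> B, star_hom g /\
  forall m k y, M (range iota) m k y -> g y = (z ^+ m * Num.conj z ^+ k) *: y.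
Proof.
move=> z1; have [g [hg g1 giota gS]] :=
  crossed_product_universal cp (gauge_covariant z1).
exists g; split=> // m k y My.
have gSw mu : g (S_word S mu) = z ^+ size mu *: S_word S mu.
  elim: mu => [|a mu IH] /=; first by rewrite S_word_nil g1 scale1r.
  by rewrite S_word_cons (star_homM hg) gS IH -scalerAl -scalerAr scalerA exprS.
rewrite {1}[y](S_word_decomp cov m k) (star_hom_sum hg).
rewrite {2}[y](S_word_decomp cov m k) scaler_sumr; apply: eq_bigr => mu _.
rewrite (star_hom_sum hg) scaler_sumr; apply: eq_bigr => nu _.
have [a _ <-] := My _ _ (size_tuple mu) (size_tuple nu).
rewrite !(star_homM hg) (star_hom_star hg) !gSw giota !size_tuple starZ.
by rewrite -!scalerAl -scalerAr scalerA rmorphXn.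
Qed.

(** [sigma] averages the gauge automorphisms at the powers of a root of unity, weighted by the Fejer
    kernel [w]. The weights are nonnegative with sum 1, whence contractivity. *)
Lemma fejer N D : (0 < N)%N -> exists sigma : B -> B,
  [/\ forall x y, sigma (x + y) = sigma x + sigma y,
      forall x, cnorm (sigma x) <= cnorm x
    & forall m k y, (`|m%:Z - k%:Z| <= D)%N -> M (range iota) m k y ->
      sigma y = ((N - `|m%:Z - k%:Z|)%:R / N%:R)%:C *: y].
Proof.
(* The exponents [a + m] and [b + k] compared below differ by less than [N + D], so a root of this
   order separates them. *)
move=> N0; pose n := (N + D)%N; have n0 : (0 < n)%N by rewrite /n; lia.
have [om omP] := prim_root_exists (R[i] : numClosedFieldType) n0.
have om1 := norm_prim_root n0 omP.
have omom : om * Num.conj om = 1 by rewrite -normCK om1 expr1n.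
have om0 : om != 0 by rewrite -normr_eq0 om1 oner_eq0.
have gP (j : 'I_n) : exists g : B -> B, star_hom g /\
    forall m k y, M (range iota) m k y ->
    g y = ((om ^+ j) ^+ m * Num.conj (om ^+ j) ^+ k) *: y.
  by apply: gauge_action; rewrite normrX om1 expr1n.
have [g gE] := choice gP.
pose W j := \sum_(a < N) (om ^+ j) ^+ a.
pose w j := (n * N)%:R^-1 * (W j * Num.conj (W j)).
have wsum m k : (`|m%:Z - k%:Z| <= D)%N ->
    \sum_(j < n) w j * ((om ^+ j) ^+ m * Num.conj (om ^+ j) ^+ k) =
    (N - `|m%:Z - k%:Z|)%:R / N%:R.
  move=> mk; pose u (a b : nat) := om ^+ (a + m) * Num.conj om ^+ (b + k).
  have uj a b j : (om ^+ j) ^+ a * Num.conj (om ^+ j) ^+ b *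
      ((om ^+ j) ^+ m * Num.conj (om ^+ j) ^+ k) = u a b ^+ j.
    rewrite mulrACA -!exprD rmorphXn /u exprMn -!exprM.
    by rewrite (mulnC j) (mulnC j (b + k)%N).
  have sumu (a b : 'I_N) : \sum_(j < n) u a b ^+ j = n%:R * (a + m == b + k)%N%:R.
    have u1 : (u a b == 1) = (a + m == b + k)%N.
      have -> : (u a b == 1) = (om ^+ (a + m) == om ^+ (b + k)).
        rewrite /u -(inj_eq (mulIf (expf_neq0 (b + k) om0))) mul1r -mulrA -exprMn.
        by rewrite (mulrC (Num.conj om)) omom expr1n mulr1.
      rewrite (eq_prim_root_expr omP).
      by apply: eq_mod_small; have := ltn_ord a; have := ltn_ord b; rewrite /n; lia.
    rewrite -u1; case: eqP => [->|/eqP un1].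
      by under eq_bigr do rewrite expr1n; rewrite sumr_const card_ord mulr1.
    (* A geometric sum with ratio [u a b != 1] and [u a b ^+ n = 1]. *)
    rewrite mulr0; apply: (mulfI (x := u a b - 1)); first by rewrite subr_eq0.
    rewrite mulr0 -subrX1 /u exprMn -!exprM !(mulnC _ n) !exprM -rmorphXn.
    by rewrite (prim_expr_order omP) rmorph1 !expr1n mulr1 subrr.
  have nR0 : n%:R != 0 :> R[i] by rewrite pnatr_eq0 -lt0n.
  have WW (j : nat) : W j * Num.conj (W j) *
      ((om ^+ j) ^+ m * Num.conj (om ^+ j) ^+ k) =
      \sum_(a < N) \sum_(b < N) u a b ^+ j.
    rewrite /W rmorph_sum big_distrlr mulr_suml; apply: eq_bigr => a _.
    rewrite mulr_suml; apply: eq_bigr => b _; rewrite -uj; congr (_ * _ * _).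
    exact: rmorphXn.
  under eq_bigr => j _ do rewrite /w -mulrA WW.
  rewrite -mulr_sumr exchange_big /=.
  under eq_bigr => a _.
    rewrite exchange_big /=.
    under eq_bigr => b _ do rewrite sumu.
    rewrite -mulr_sumr -natr_sum; over.
  rewrite -mulr_sumr -natr_sum count_diagonal natrM invfM.
  by rewrite mulrACA mulVf // mul1r mulrC.
exists (fun x => \sum_(j < n) w j *: g j x); split.
- move=> x y; rewrite -big_split; apply: eq_bigr => j _ /=.
  by case: (gE j) => hg _; rewrite (star_homD hg) scalerDr.
- move=> x; rewrite -(@lecR R).
  have w1 : \sum_(j < n) w j = 1.
    have := wsum 0%N 0%N; rewrite subrr absz0 subn0 => /(_ (leq0n D)).
    rewrite divff ?pnatr_eq0 -?lt0n // => <-.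
    by apply: eq_bigr => j _; rewrite !expr0 !mulr1.
  apply: (le_trans (y := (\sum_(j < n) cnorm (w j *: g j x))%:C)).
    by rewrite lecR cnorm_sum.
  rewrite -[X in _ <= X]mul1r -w1 mulr_suml rmorph_sum; apply: ler_sum => j _.
  have w0 : 0 <= w j by rewrite mulr_ge0 ?invr_ge0 ?ler0n // mul_conjC_ge0.
  rewrite [X in X <= _]cnormZ ger0_norm // ler_wpM2l // lecR.
  by case: (gE j) => hg _; exact: star_hom_contractive.
move=> m k y mk My.
rewrite rmorphM fmorphV !rmorph_nat -wsum // scaler_suml; apply: eq_bigr => j _.
by case: (gE j) => _ /(_ _ _ _ My) ->; rewrite scalerA.
Qed.

End Gauge.

(** * Simplicity *)

Section Simplicity.
Context {R : realType} {A B : cstarType R} {Sigma : finType}.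
Variables (rho : Sigma -> A -> A) (iota : A -> B) (S : Sigma -> B).
Hypothesis cp : is_crossed_product rho iota S.

Variable Al : nat -> set A.
Hypothesis Al_cstar : forall l, cstar_subalgebra (Al l).
Hypothesis Al1 : forall l, Al l 1.
Hypothesis Al_incr : forall l, Al l `<=` Al l.+1.
Hypothesis Al_rho : forall l a, rho a @` Al l `<=` Al l.+1.
Hypothesis Al_dense : dense (\bigcup_l Al l).
Hypothesis condI : forall k l : nat, (0 < k)%N -> (k <= l)%N ->
  exists q : B, [/\ D_rho rho iota S q, projection q,
    (forall a, Al l a -> q * iota a = iota a * q),
    (forall a, Al l a -> a <> 0 -> q * iota a <> 0)
    & (forall m, (1 <= m <= k)%N -> q * phi_rho rho S m q = 0)].

Let cov := crossed_product_covariant cp.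
Let hom_iota : star_hom iota := covariant_hom cov.
Notation H := (homogeneous iota S Al).

(** Elements with finitely many nonzero Fourier coefficients for the gauge action. *)
Definition gauge_polynomial (y : B) : Prop := exists s : seq (int * B),
  (forall t, t \in s -> homogeneous iota S Al t.1 t.2) /\ y = \sum_(t <- s) t.2.

Lemma homogeneous_polynomial n y : H n y -> gauge_polynomial y.
Proof.
move=> yn; exists [:: (n, y)]; split; last by rewrite big_seq1.
by move=> t; rewrite inE => /eqP ->.
Qed.

Lemma polynomial_star_subalg : star_subalg gauge_polynomial.
Proof.
split.
- by exists [::]; rewrite big_nil.
- move=> _ _ [s [sP ->]] [s' [s'P ->]]; exists (s ++ s'); split.
    by move=> t; rewrite mem_cat => /orP[/sP|/s'P].
  by rewrite big_cat.
- move=> c _ [s [sP ->]]; exists [seq (t.1, c *: t.2) | t <- s]; split.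
    by move=> _ /mapP[t /sP ts ->]; exact: (homogeneousZ cov Al_cstar).
  by rewrite big_map scaler_sumr.
- move=> _ _ [s [sP ->]] [s' [s'P ->]].
  exists [seq (t.1 + u.1, t.2 * u.2) | t <- s, u <- s']; split.
    move=> _ /allpairsP[[t u] [/= /sP tP /s'P uP ->]].
    exact: (homogeneousM cov Al_cstar).
  rewrite big_allpairs_dep /= mulr_suml; apply: eq_bigr => t _.
  by rewrite mulr_sumr.
move=> _ [s [sP ->]]; exists [seq (- t.1, star t.2) | t <- s]; split.
  by move=> _ /mapP[t /sP ts ->]; exact: (homogeneous_star cov Al_cstar).
by rewrite big_map star_sum.
Qed.

(** The closure is a C*-subalgebra, so it suffices that it contains the generators; for those from
    [A], use the density of the union of the [Al l]. *)
Lemma polynomial_dense : cl gauge_polynomial = setT.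
Proof.
apply/seteqP; split=> // x _.
have : cstar_generated (range iota `|` range S) x.
  by rewrite (crossed_product_generated cp).
apply; split.
  by apply: cl_cstar_subalgebra; exact: polynomial_star_subalg.
move=> _ [[a _ <-]|[a _ <-]]; last first.
  apply: subset_cl; apply: (@homogeneous_polynomial 1).
  exact: (homogeneous_S cov Al_cstar Al1 Al_incr Al_rho).
suff : cl (\bigcup_l Al l) `<=` [set a | cl gauge_polynomial (iota a)].
  by rewrite dense_cl //; apply.
apply: cl_min.
  by apply: (closed_star_hom_preimage hom_iota); exact: closed_cl.
move=> {}a [l _ Aa]; apply: subset_cl; apply: (@homogeneous_polynomial 0).
exact: (homogeneous_iota cov Al_cstar Al_incr Al_rho Aa).
Qed.

Lemma homogeneous_range n y : H n y -> exists m k,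
  m%:Z - k%:Z = n /\ word_matrix S (range iota) m k y.
Proof.
(* The summand [|n|] in [k] keeps [k + n] nonnegative and above [N]. *)
move=> [N NP]; pose k := (N + `|n|)%N; pose m := absz (k%:Z + n).
have mk : m%:Z - k%:Z = n by rewrite /m /k; lia.
exists m, k; split=> //.
apply: (@word_matrix_sub _ _ _ S (iota @` Al (N + m + k)%N)).
  by move=> _ [a _ <-]; exists a.
by apply: NP => //; rewrite /m /k; lia.
Qed.

(** Regrouping by degree. Degrees with [|n| >= N] have weight 0 by truncated subtraction; the others
    are indexed by [i = n + N] below [2 N]. *)
Lemma polynomial_fejer N (s : seq (int * B)) : (0 < N)%N ->
  \sum_(t <- s) ((N - `|t.1|)%:R / N%:R : R)%:C *: t.2 =
  \sum_(i < N + N) ((N - `|i%:Z - N%:Z|)%:R / N%:R : R)%:C *: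
    \sum_(t <- s | t.1 == i%:Z - N%:Z) t.2.
Proof.
move=> N0; under [RHS]eq_bigr => i _ do rewrite scaler_sumr big_mkcond.
rewrite exchange_big; apply: eq_bigr => -[n y] _ /=.
have [nN|nN] := ltnP `|n| N.
  have iN : (absz (n + N%:Z)%R < N + N)%N by lia.
  rewrite (bigD1 (Ordinal iN)) //= big1 => [|i /eqP iN'].
    by rewrite addr0 (_ : (absz (n + N%:Z)%R)%:Z - N%:Z = n) ?eqxx //; lia.
  case: eqP => // nE; case: iN'; apply: val_inj => /=; lia.
rewrite (_ : (N - `|n|)%N = 0%N); last by lia.
rewrite mul0r scale0r big1 // => i _; case: eqP => // nE.
by rewrite -nE (_ : (N - `|n|)%N = 0%N) ?mul0r ?scale0r //; lia.
Qed.

Variable J : set B.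
Hypothesis iJ : closed_ideal J.
Hypothesis sJ : forall x, J x -> J (star x).
Hypothesis Jiota : forall x, J (iota x) -> x = 0.

(** Two approximants of [x] are needed: [p] determines [N], and [N] determines the precision of [y].
    Contractivity of [sigma] compares them, and [x] is bounded through [p], [sigma p] and
    [sigma y]. *)
Lemma ideal_eq0 x : J x -> x = 0.
Proof.
move=> Jx; apply: eq0_small => e e0.
have dense_x d : 0 < d -> exists2 s : seq (int * B),
    (forall t, t \in s -> H t.1 t.2) & cnorm (x - \sum_(t <- s) t.2) < d.
  move=> d0; have : cl gauge_polynomial x by rewrite polynomial_dense.
  by move=> /(_ d d0)[_ [s [sP ->]] xs]; exists s.
have e8 : 0 < e / 8 by rewrite divr_gt0.
have [s sP xs] := dense_x _ e8; set p := \sum_(t <- s) t.2 in xs.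
(* [C / N] bounds [p - sigma p], because the Fejer weight of degree [n] is within [|n| / N] of 1. *)
pose C := \sum_(t <- s) `|t.1|%:R * cnorm t.2.
have C0 : 0 <= C by apply: sumr_ge0 => t _; rewrite mulr_ge0 ?cnorm_ge0.
pose N := (Num.truncn (C / (e / 8))).+1.
have N0 : 0 < N%:R :> R by rewrite ltr0n.
have CN : C / N%:R < e / 8.
  rewrite ltr_pdivrMr // mulrC -ltr_pdivrMr //; exact: truncnS_gt.
have N1 : 1 <= N%:R :> R by rewrite ler1n.
(* With this precision each homogeneous component of [y] has norm at most [e / (16 N)], and
   [sigma y] involves at most [2 N] of them. *)
have d0 : 0 < e / 16 / N%:R by rewrite !divr_gt0.
have [r rP xr] := dense_x _ d0; set y := \sum_(t <- r) t.2 in xr.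
pose D := (\sum_(t <- s) `|t.1| + \sum_(t <- r) `|t.1|)%N.
have [sigma [sigmaD sigma_le sigmaE]] := fejer cp D (ltn0Sn _ : 0 < N)%N.
have sigma0 : sigma 0 = 0 by apply: (addIr (sigma 0)); rewrite -sigmaD !add0r.
have sigma_poly u : (forall t, t \in u -> H t.1 t.2 /\ (`|t.1| <= D)%N) ->
    sigma (\sum_(t <- u) t.2) = \sum_(t <- u) ((N - `|t.1|)%:R / N%:R : R)%:C *: t.2.
  move=> uP; rewrite (big_morph sigma sigmaD sigma0) big_seq [RHS]big_seq.
  apply: eq_bigr => -[n z] /uP[/= /homogeneous_range[m [k [<- Mz]]] nD].
  exact: sigmaE.
have le_seq (u : seq (int * B)) t : t \in u -> (`|t.1| <= \sum_(t <- u) `|t.1|)%N.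
  by move=> tu; rewrite (big_rem t) //= leq_addr.
have sigma_p : cnorm (p - sigma p) <= C / N%:R.
  rewrite sigma_poly => [|t ts]; last first.
    by split; [exact: sP|rewrite (leq_trans (le_seq _ _ ts)) // leq_addr].
  rewrite /p -sumrB (le_trans (cnorm_sum _ _ _)) // /C mulr_suml.
  apply: ler_sum => t _.
  rewrite -{1}[t.2]scale1r -scalerBl -(rmorph1 (real_complex R)) -rmorphB.
  rewrite cnorm_scaleR mulrAC ler_wpM2r ?cnorm_ge0 //.
  have -> : 1 - (N - `|t.1|)%:R / N%:R = (N%:R - (N - `|t.1|)%:R) / N%:R :> R.
    by rewrite mulrBl divff ?gt_eqF.
  rewrite -natrB ?leq_subr // ger0_norm ?divr_ge0 //.
  by rewrite ler_pM2r ?invr_gt0 // ler_nat; lia.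
have sigma_y : cnorm (sigma y) <= e / 8.
  rewrite sigma_poly => [|t tr]; last first.
    by split; [exact: rP|rewrite (leq_trans (le_seq _ _ tr)) // leq_addl].
  rewrite polynomial_fejer // (le_trans (cnorm_sum _ _ _)) //.
  apply: (le_trans (y := \sum_(i < N + N) e / 16 / N%:R)).
    apply: ler_sum => i _; rewrite cnorm_scaleR.
    have le1 : (N - `|i%:Z - N%:Z|)%:R / N%:R <= 1 :> R.
      by rewrite ler_pdivrMr // mul1r ler_nat leq_subr.
    rewrite ger0_norm ?divr_ge0 // -[X in _ <= X]mul1r ler_pM ?divr_ge0 ?cnorm_ge0 //.
    rewrite (le_trans _ (ltW xr)) // cdistC.
    exact: (degree_dist_ideal cov Al_cstar Al1 Al_incr Al_rho condI Al_dense iJ sJ Jiota).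
  rewrite sumr_const card_ord -[_ *+ (N + N)]mulr_natr natrD.
  have -> : e / 16 / N%:R * (N%:R + N%:R) = e / 8 by field; rewrite gt_eqF.
  exact: lexx.
have yr : cnorm (x - y) < e / 16.
  by rewrite (lt_le_trans xr) // ler_pdivrMr // ler_peMr // ltW // divr_gt0.
have sigma_py : cnorm (sigma p - sigma y) <= cnorm (x - p) + cnorm (x - y).
  have -> : sigma p - sigma y = sigma (p - y).
    by apply/eqP; rewrite subr_eq -sigmaD subrK.
  rewrite (le_trans (sigma_le _)) // -(subrKA x) (le_trans (cnormD _ _)) //.
  by rewrite (cdistC p).
have -> : x = (x - p) + ((p - sigma p) + ((sigma p - sigma y) + sigma y)).
  by rewrite !subrK.
have := cnormD (x - p) ((p - sigma p) + ((sigma p - sigma y) + sigma y)).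
have := cnormD (p - sigma p) ((sigma p - sigma y) + sigma y).
have := cnormD (sigma p - sigma y) (sigma y).
lra.
Qed.

End Simplicity.

Theorem corollary3p11 (R : realType) (A : cstarType R) (Sigma : finType)
    (rho : Sigma -> A -> A)
    (B : cstarType R) (iota : A -> B) (S : Sigma -> B) :
  cstar_symbolic_dynamical_system rho ->
  is_crossed_product rho iota S ->
  condition_I rho iota S ->
  irreducible_system rho ->
  simple_cstar B.
Proof.
move=> sys cp [Al [Al_sub Al_incr Al_rho Al_dense condI]] irr [J [iJ J0 JT]].
have cov := crossed_product_covariant cp.
have hom_iota := covariant_hom cov.
(* A closed ideal is selfadjoint, but its largest selfadjoint part suffices. *)
pose J' := [set x | J x /\ J (star x)].
have closedJ' : closed J'.
  apply: closedI; first exact: closed_ideal_closed iJ.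
  apply: (closed_preimage (K := 1)); first exact: starB.
    by move=> x; rewrite cnorm_starE mul1r.
  exact: closed_ideal_closed iJ.
have iJ' : closed_ideal J'.
  split=> //.
  - by rewrite /J' /= star0; split; exact: closed_ideal0.
  - move=> x y [Jx Jx'] [Jy Jy']; split; first exact: closed_idealD.
    by rewrite starD; exact: closed_idealD.
  - move=> c x [Jx Jx']; split; first exact: closed_idealZ.
    by rewrite starZ; exact: closed_idealZ.
  - move=> a x [Jx Jx']; split; first exact: closed_idealMl.
    by rewrite starM; exact: closed_idealMr.
  move=> a x [Jx Jx']; split; first exact: closed_idealMr.
  by rewrite starM; exact: closed_idealMl.
have sJ' x : J' x -> J' (star x) by case=> Jx Jx'; split; rewrite ?starK.
have Jiota x : J' (iota x) -> x = 0.
  (* The preimage of [J'] in [A] is an invariant ideal, nonzero because of [x] and proper because 1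
     in it would force [J] to be everything. *)
  move=> Jx; apply: contrapT => x0; apply: irr.
  exists [set a | J' (iota a)]; split; first split.
  - split.
    + by rewrite /= (star_hom0 hom_iota); exact: closed_ideal0.
    + by move=> a b ? ?; rewrite /= (star_homD hom_iota); exact: closed_idealD.
    + by move=> c a ?; rewrite /= (star_homZ hom_iota); exact: closed_idealZ.
    + by move=> a b ?; rewrite /= (star_homM hom_iota); exact: closed_idealMl.
    + by move=> a b ?; rewrite /= (star_homM hom_iota); exact: closed_idealMr.
    exact: closed_star_hom_preimage.
  - by move=> I0; apply: x0; have : [set a | J' (iota a)] x by []; rewrite I0.
  - move=> IT; apply: JT; apply/seteqP; split=> // y _.
    have [+ _] : [set a | J' (iota a)] 1 by rewrite IT.
    rewrite (covariant_unital cov) -[y]mulr1; exact: closed_idealMl.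
  (* Each summand is [iota (rho b a) = star (S b) * iota a * S b]. *)
  move=> _ [a /= Ja <-]; rewrite /lambda_rho (star_hom_sum hom_iota).
  apply: big_ind => [||b _]; [exact: closed_ideal0|exact: closed_idealD|].
  rewrite -(covariant_rho cov); apply: closed_idealMr => //.
  exact: closed_idealMl.
apply: J0; apply/seteqP; split=> x /= => [Jx|->]; last exact: closed_ideal0.
(* [star x * x] is selfadjoint and in [J], hence in [J'], so [ideal_eq0] applies to it. *)
apply: cnorm0_eq0; apply/eqP; rewrite -sqrf_eq0 -cnorm_star.
have -> : star x * x = 0; last by rewrite cnorm0.
have Al_cstar l := (Al_sub l).1; have Al1 l := (Al_sub l).2.
apply: (ideal_eq0 cp Al_cstar Al1 Al_incr Al_rho Al_dense condI iJ' sJ' Jiota).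
by split; rewrite ?starM ?starK; exact: closed_idealMl.
Qed.
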